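(* Let $G$ and $H$ be (finite, undirected) graphs. The following are equivalent: (i) $\mathcal{S}_G$ and $\mathcal{S}_H$ are TRO-equivalent; (ii) $\mathcal{S}_G$ and $\mathcal{S}_H$ are $\Delta$-equivalent; (iii) $G$ and $H$ are pullbacks of isomorphic graphs.
   Context: For an undirected graph $G$ with vertex set $[d]=\{1,\dots,d\}$ write $i\sim j$ if $\{i,j\}$ is an edge and $i\simeq j$ if $i\sim j$ or $i=j$. The graph operator system of $G$ is $\mathcal{S}_G=\mathrm{span}\{E_{i,j}:i\simeq j\}\subseteq M_d$, where $(E_{i,j})$ are the canonical matrix units. For graphs $G$ on $[k]$ and $H$ on $[m]$, $G$ is a pullback of $H$ if there is a surjective map $f:[k]\to[m]$ such that $x\simeq x'$ in $G$ if and only if $f(x)\simeq f(x')$ in $H$. Item (iii) means that $G$ is a pullback of some graph $G'$ and $H$ is a pullback of some graph $H'$ with $G'$ and $H'$ isomorphic. $[\,\cdot\,]$ is norm-closed linear span. A TRO is a linear subspace $\mathcal{M}\subseteq\mathcal{B}(L,K)$ ($L,K$ Hilbert spaces) with $\mathcal{M}\mathcal{M}^*\mathcal{M}\subseteq\mathcal{M}$; it is non-degenerate if $I_L\in[\mathcal{M}^*\mathcal{M}]$ and $I_K\in[\mathcal{M}\mathcal{M}^*]$. Concrete operator systems $\mathcal{S}\subseteq\mathcal{B}(L)$, $\mathcal{T}\subseteq\mathcal{B}(K)$ are TRO-equivalent if there is a non-degenerate TRO $\mathcal{M}\subseteq\mathcal{B}(L,K)$ with $\mathcal{M}^*\mathcal{T}\mathcal{M}\subseteq\overline{\mathcal{S}}$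 and $\mathcal{M}\mathcal{S}\mathcal{M}^*\subseteq\overline{\mathcal{T}}$; in (i) the inclusions $\mathcal{S}_G\subseteq M_d$, $\mathcal{S}_H\subseteq M_{d'}$ are used. Operator systems are $\Delta$-equivalent if they have unital complete order embeddings (into possibly different $\mathcal{B}(L)$, $\mathcal{B}(K)$) with TRO-equivalent images. *)

(* Defs.v *)
From HB Require Import structures.
From mathcomp Require Import all_boot all_order all_algebra.
From mathcomp Require Import sesquilinear complex.
From mathcomp Require Import boolp classical_sets functions reals topology.
From mathcomp Require Import normedtype.
Set Implicit Arguments.
Unset Strict Implicit.
Unset Printing Implicit Defensive.
Import Order.TTheory GRing.Theory Num.Theory.
Import numFieldNormedType.Exports.
Local Open Scope classical_set_scope.
Local Open Scope ring_scope.

(* The inner product is linear in its first argument. *)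
HB.mixin Record isHilbert (R : realType) V of CompleteNormedModule R[i] V := {
  inner : {dot V for @Num.conj R[i]};
  inner_norm : forall x : V, inner x x = `|x| ^+ 2
}.

#[short(type="hilbertType")]
HB.structure Definition Hilbert (R : realType) :=
  {V of CompleteNormedModule R[i] V & isHilbert R V}.

Section CVDot.
Variables (R : realType) (d : nat).
Implicit Types x y : 'cV[R[i]]_d.

Definition cdot x y : R[i] := \sum_k x k ord0 * (y k ord0)^*.

Let cdot_linearl y : linear_for *%R (cdot ^~ y).
Proof.
move=> a x x'; rewrite /cdot mulr_sumr -big_split /=.
by apply: eq_bigr => k _; rewrite !mxE mulrDl mulrA.
Qed.

Let cdot_herm x y : cdot x y = (-1) ^+ false * (cdot y x)^*.
Proof.
rewrite expr0 mul1r /cdot rmorph_sum /=.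
apply: eq_bigr => k _; rewrite rmorphM /=.
by rewrite conjCK mulrC.
Qed.

Let cdot_linearr x : linear_for (@Num.conj R[i] \; *%R) (cdot x).
Proof.
move=> a y y'; rewrite cdot_herm cdot_linearl expr0 mul1r rmorphD rmorphM /=.
by congr (_ * _ + _); rewrite [in RHS]cdot_herm expr0 mul1r.
Qed.

HB.instance Definition _ := bilinear_isBilinear.Build
  R[i] _ _ _ *%R (@Num.conj R[i] \; *%R) cdot (conj cdot_linearl cdot_linearr).

HB.instance Definition _ := isHermitianSesquilinear.Build R[i] _ false
  (@Num.conj R[i]) cdot cdot_herm.

Lemma cdotE x : cdot x x = \sum_k `|x k ord0| ^+ 2.
Proof. by apply: eq_bigr => k _; rewrite normCK. Qed.

Let cdot_gt0 x : x != 0 -> 0 < cdot x x.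
Proof.
move=> x0; rewrite cdotE lt_def sumr_ge0 ?andbT; last first.
  by move=> k _; rewrite exprn_ge0.
apply: contra x0; rewrite psumr_eq0; last by move=> k _; rewrite exprn_ge0.
move=> /allP xk0; apply/eqP/matrixP => k j; rewrite ord1 mxE.
by have /= := xk0 k; rewrite mem_index_enum expf_eq0 normr_eq0 => /(_ isT)/eqP.
Qed.

HB.instance Definition _ := isDotProduct.Build R[i] _ cdot cdot_gt0.

End CVDot.

(* C^d with its Euclidean norm; on the type of matrices itself, MathComp-Analysis
   puts the sup norm. *)
Definition euclid (R : realType) (d : nat) : Type := 'cV[R[i]]_d.

Section Euclid.
Variables (R : realType) (d : nat).

HB.instance Definition _ := GRing.Lmodule.copy (euclid R d) 'cV[R[i]]_d.

Definition euclid_norm (x : euclid R d) : R[i] := sqrtC (cdot x x).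

Let euclid_normD (x y : euclid R d) :
  euclid_norm (x + y) <= euclid_norm x + euclid_norm y.
Proof. by rewrite (triangle_lerif (@cdot R d : {dot _ for _})). Qed.

Let euclid_normZ (a : R[i]) (x : euclid R d) :
  euclid_norm (a *: x) = `|a| * euclid_norm x.
Proof.
rewrite /euclid_norm (dnormZ (@cdot R d : {dot _ for _})).
by rewrite sqrtCM ?nnegrE ?exprn_ge0// ?sqrCK// (dnorm_ge0 (@cdot R d : {dot _ for _})).
Qed.

Let euclid_norm_eq0 (x : euclid R d) : euclid_norm x = 0 -> x = 0.
Proof.
move=> /eqP; rewrite sqrtC_eq0.
by rewrite (dnorm_eq0 (@cdot R d : {dot _ for _})) => /eqP.
Qed.

HB.instance Definition _ := Lmodule_isNormed.Build R[i] (euclid R d)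
  euclid_normD euclid_normZ euclid_norm_eq0.

Lemma euclid_normE (x : euclid R d) : `|x| = sqrtC (\sum_k `|x k ord0| ^+ 2).
Proof. by rewrite -cdotE. Qed.

Lemma euclid_coord_le (x : euclid R d) k : `|x k ord0| <= `|x|.
Proof.
rewrite euclid_normE -[leLHS]sqrCK// ler_sqrtC ?nnegrE ?exprn_ge0//.
  by rewrite (bigD1 k)//= lerDl sumr_ge0// => j _; rewrite exprn_ge0.
by rewrite sumr_ge0// => j _; rewrite exprn_ge0.
Qed.

Lemma euclid_norm_le (x : euclid R d) e : 0 <= e ->
  (forall k, `|x k ord0| <= e) -> `|x| <= d%:R * e.
Proof.
move=> e0 xe.
have de0 : 0 <= d%:R * e by rewrite mulr_ge0 ?ler0n.
rewrite euclid_normE -[leRHS]sqrCK// ler_sqrtC ?nnegrE ?exprn_ge0//; last first.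
  by rewrite sumr_ge0// => j _; rewrite exprn_ge0.
apply: (@le_trans _ _ (\sum_(k < d) e ^+ 2)).
  by apply: ler_sum => k _; rewrite ler_sqr ?nnegrE.
rewrite sumr_const card_ord -[leLHS]mulr_natl exprMn ler_wpM2r ?exprn_ge0//.
by rewrite -natrX ler_nat -mulnn; case: (d) => // n; exact: leq_pmulr.
Qed.

Let normc_ge_Im (z : R[i]) : `|complex.Im z|%:C%C <= `|z|.
Proof.
by rewrite normc_def lecR -sqrtr_sqr ler_wsqrtr// lerDr sqr_ge0.
Qed.

Let euclid_complete (F : set_system (euclid R d)) :
  ProperFilter F -> cauchy F -> cvg F.
Proof.
move=> FF /cauchy_ballP Fc.
have cre (f : euclid R d -> R) :
    (forall x y, `|f x - f y|%:C%C <= `|x - y|) -> cvg (f @ F).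
  move=> fle; apply: cauchy_cvg; apply/cauchy_ballP => e e0.
  have eC0 : (0 : R[i]) < e%:C%C by rewrite ltcR.
  rewrite near_map2.
  apply: filterS (Fc _ eC0) => -[x y]; rewrite -!ball_normE /= => xy.
  by rewrite -ltcR; exact: le_lt_trans (fle x y) xy.
pose re k (x : euclid R d) := complex.Re (x k ord0).
pose im k (x : euclid R d) := complex.Im (x k ord0).
have rele k x y : `|re k x - re k y|%:C%C <= `|x - y|.
  apply: le_trans (euclid_coord_le (x - y) k).
  by rewrite !mxE /re -raddfB; exact: normc_ge_Re.
have imle k x y : `|im k x - im k y|%:C%C <= `|x - y|.
  apply: le_trans (euclid_coord_le (x - y) k).
  by rewrite !mxE /im -raddfB; exact: normc_ge_Im.
pose l : euclid R d := \col_k (Complex (lim (re k @ F)) (lim (im k @ F))).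
apply/cvg_ex; exists l; apply/cvgrPdist_le => e e0.
have d1 : 0 < (d.*2.+1)%:R :> R[i] by rewrite ltr0n.
pose e' := e / (d.*2.+1)%:R.
have e'0 : 0 < e' by rewrite divr_gt0.
pose r := complex.Re e'.
have rE : r%:C%C = e' by rewrite RRe_real// realE ltW.
have r0 : 0 < r by rewrite -ltcR rE.
near=> x.
have: `|l - x| <= d%:R * (e' + e').
  apply: euclid_norm_le; first by rewrite addr_ge0// ltW.
  move=> k; rewrite !mxE.
  rewrite [X in `|X|](_ : _ = (lim (re k @ F) - re k x)%:C%C +
      'i%C * (lim (im k @ F) - im k x)%:C%C); last first.
    by rewrite /re /im; case: (x k ord0) => a b; simpc.
  apply: le_trans (ler_normD _ _) _; rewrite normrM normCi mul1r.
  have nR (u : R) : `|u%:C%C| = `|u|%:C%C.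
    by rewrite normc_def /= expr0n addr0 sqrtr_sqr.
  rewrite !nR -rE; apply: lerD; rewrite lecR; move: (k); near: x.
    apply: filter_forall => j.
    exact: cvgr_dist_le (cre _ (rele j)) _ r0.
  apply: filter_forall => j.
  exact: cvgr_dist_le (cre _ (imle j)) _ r0.
move/le_trans; apply.
rewrite -mulr2n -[e' *+ 2]mulr_natl mulrA -natrM muln2 mulrCA.
by rewrite (ler_piMr (ltW e0))// ler_pdivrMr// mul1r ler_nat.
Unshelve. all: by end_near.
Qed.

HB.instance Definition _ := Uniform_isComplete.Build (euclid R d) euclid_complete.

Let euclid_innerE (x : euclid R d) : cdot x x = `|x| ^+ 2.
Proof. by rewrite euclid_normE sqrtCK cdotE. Qed.

HB.instance Definition _ := isHilbert.Build R (euclid R d) euclid_innerE.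

End Euclid.

Definition linspan (C : nzRingType) (V : lmodType C) (X : set V) : set V :=
  [set v | exists (n : nat) (c : 'I_n -> C) (u : 'I_n -> V),
     (forall i, X (u i)) /\ v = \sum_i c i *: u i].

Definition linsubspace (C : nzRingType) (V : lmodType C) (X : set V) :=
  X 0 /\ forall (a : C) (u v : V), X u -> X v -> X (a *: u + v).

(* Operators are bare functions, added and scaled pointwise; [bounded_op]
   carves B(L, K) out of all functions. *)
Section Operators.
Variable R : realType.
Implicit Types L K H : hilbertType R.

Definition bounded_op {L K} : set (L -> K) :=
  [set T | linear T /\ continuous T].

(* The operator norm of T is at most c. *)
Definition opnorm_le {L K} (T : L -> K) (c : R[i]) :=
  forall x, `|T x| <= c * `|x|.

Definition opclosure {L K} (X : set (L -> K)) : set (L -> K) :=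
  [set T | bounded_op T /\
     forall e : R[i], 0 < e -> exists2 S, X S & opnorm_le (T - S) e].

Definition closed_span {L K} (X : set (L -> K)) := opclosure (linspan X).

Definition opadj {L K} (M : set (L -> K)) : set (K -> L) :=
  [set T' | bounded_op T' /\
     exists2 T, M T & forall x y, inner (T x) y = inner x (T' y)].

Definition opmul {L H K} (X : set (H -> K)) (Y : set (L -> H)) : set (L -> K) :=
  [set S \o T | S in X & T in Y].

Definition TRO {L K} (M : set (L -> K)) :=
  [/\ M `<=` bounded_op, linsubspace M
    & opmul M (opmul (opadj M) M) `<=` M].

Definition nondegenerate {L K} (M : set (L -> K)) :=
  closed_span (opmul (opadj M) M) id /\ closed_span (opmul M (opadj M)) id.

Definition TRO_equiv {L K} (S : set (L -> L)) (T : set (K -> K)) :=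
  exists M : set (L -> K),
    [/\ TRO M, nondegenerate M,
        opmul (opadj M) (opmul T M) `<=` opclosure S
      & opmul M (opmul S (opadj M)) `<=` opclosure T].

(* T is positive as an operator on the direct sum of n copies of H. *)
Definition mx_pos {H} n (T : 'M[H -> H]_n) :=
  forall xi : 'I_n -> H, 0 <= \sum_i \sum_j inner (T i j (xi j)) (xi i).

(* Only the values of phi on S matter. *)
Definition unital_complete_order_embedding {H L} (S : set (H -> H))
    (phi : (H -> H) -> (L -> L)) :=
  [/\ forall A, S A -> bounded_op (phi A),
      forall (a : R[i]) A B, S A -> S B -> phi (a *: A + B) = a *: phi A + phi B,
      phi id = id,
      forall A B, S A -> S B -> phi A = phi B -> A = B
    & forall n (T : 'M[H -> H]_n), (forall i j, S (T i j)) ->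
        mx_pos T <-> mx_pos (map_mx phi T)].

Definition Delta_equiv {H1 H2 : hilbertType R}
    (S : set (H1 -> H1)) (T : set (H2 -> H2)) :=
  exists (L K : hilbertType R)
    (phi : (H1 -> H1) -> (L -> L)) (psi : (H2 -> H2) -> (K -> K)),
    [/\ unital_complete_order_embedding S phi,
        unital_complete_order_embedding T psi
      & TRO_equiv (phi @` S) (psi @` T)].

End Operators.

Record sgraph (d : nat) := SGraph {
  adj : rel 'I_d;
  adj_sym : symmetric adj;
  adj_irr : irreflexive adj
}.

Definition adjeq d (G : sgraph d) : rel 'I_d := [rel i j | adj G i j || (i == j)].

Definition pullback k m (G : sgraph k) (H : sgraph m) :=
  exists f : 'I_k -> 'I_m, (forall y, exists x, f x = y) /\
    forall x x', adjeq G x x' <-> adjeq H (f x) (f x').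

Definition graph_iso k m (G : sgraph k) (H : sgraph m) :=
  exists2 f : 'I_k -> 'I_m, bijective f &
    forall x x', adj G x x' <-> adj H (f x) (f x').

Definition mx_op (R : realType) d (A : 'M[R[i]]_d) : euclid R d -> euclid R d :=
  fun x => A *m x.

Definition graph_opsys (R : realType) d (G : sgraph d) :
    set (euclid R d -> euclid R d) :=
  mx_op (d:=d) @` linspan [set A : 'M[R[i]]_d |
    exists i j, adjeq G i j /\ A = delta_mx i j].

Arguments graph_opsys R {d} G.

(* Main.v *)
Require Import Defs.
From HB Require Import structures.
From mathcomp Require Import all_boot all_order all_algebra.
From mathcomp Require Import sesquilinear complex.
From mathcomp Require Import boolp classical_sets functions reals topology.
From mathcomp Require Import normedtype.
From mathcomp Require Import perm ring.
Set Implicit Arguments.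
Unset Strict Implicit.
Unset Printing Implicit Defensive.
Import Order.TTheory GRing.Theory Num.Theory.
Import numFieldNormedType.Exports.
Local Open Scope classical_set_scope.
Local Open Scope ring_scope.

(* If G and H are pullbacks of one graph along c and c', the matrices whose
   (y, x) entry vanishes unless c' y = c x form a TRO implementing the
   equivalence, and the inclusions of S_G and S_H are complete order embeddings.

   For the converse let phi, psi be embeddings with TRO-equivalent images and
   theta = phi^-1. For a in the span of M^* M and i ~ j one has
   theta (a phi(E_ij)) = theta(a) E_ij: this is a multiplicative domain argument
   carried out on a 3 x 3 positive matrix with entries in phi(S_G), so that no
   extension of theta to B(L) is needed. Hence theta(a) only relates vertices
   with the same closed neighbourhood. Non-degeneracy gives finitely many p_i in
   M with sum p_i^* p_i and sum p_i p_i^* bounded below. On the pairs (p_i, x),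
   standing for p_i (x) e_x in the tensor product of M and C^d over M^* M, the
   Gram matrix is theta(p_i^* p_j)_{x y}; a maximal nondegenerate subfamily
   indexes the vertices of a graph G' pulled back from G, with two linear maps
     B |-> theta(p_i^* psi(B) p_j)_{x_i x_j},
     A |-> psi^-1 (sum_ij A_ij p_i phi(E_{x_i x_j}) p_j^* )
   between S_H and S_G' that preserve and reflect positivity.

   Such a map F between graph operator systems comes with an isomorphism of
   graphs: since E_kk is at most t 1 only for t >= 1, F(1) - F(E_kk) has a kernel
   vector v_k outside ker F(1). The v_k are independent, so both graphs have
   equally many vertices; if W is the inverse of the matrix with columns v_k, then
   F(E_kl) has entries c conj(W_ki) W_lj with c <> 0, and any permutation whose
   term in the Leibniz expansion of det W is nonzero preserves adjacency. So H is
   isomorphic to G', and both G and G' are pullbacks of the quotient of G by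
   equality of closed neighbourhoods. *)

(** * Positive semidefinite complex matrices *)

Section Scalars.
Variable C : numClosedFieldType.
Implicit Types a q r s t z w : C.

(** Both sums are real: the first gives Im w = - Im z, the second Re w = Re z. The second hypothesis
    is the first one after multiplying one of two vectors by ['i]. *)
Lemma conj_of_ge0 a z w q : 0 <= a -> 0 <= q ->
  0 <= a + z + w + q -> 0 <= a + 'i * z - 'i * w + q -> w = z^*.
Proof.
move=> a0 q0 h1 h2.
have ra := CrealP (ger0_real a0); have rq := CrealP (ger0_real q0).
have := CrealP (ger0_real h1); have := CrealP (ger0_real h2).
rewrite !rmorphD rmorphN !rmorphM /= ra rq conjCi => e2 e1.
have e1' : z^* + w^* = z + w by apply: (addrI a); apply: (addIr q); rewrite !addrA.
have e2' : 'i * (w^* - z^*) = 'i * (z - w).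
  apply: (addrI a); apply: (addIr q); transitivity (a + 'i * z - 'i * w + q).
    by rewrite -e2; ring.
  by ring.
have {}e2' := mulfI (neq0Ci C) e2'.
have e3 : w *+ 2 = z^* *+ 2.
  transitivity (z + w - (z - w)); first by rewrite mulr2n; ring.
  by rewrite -e1' -e2' mulr2n; ring.
by apply: (@mulIf C 2%:R); rewrite ?pnatr_eq0// !mulr_natr.
Qed.

Lemma affine_ge0_eq0 r z w :
  (forall t, 0 <= r + t * z + t^* * w) -> z = 0 /\ w = 0.
Proof.
move=> h; have r0 : 0 <= r by have := h 0; rewrite rmorph0 !mul0r !addr0.
have wz : w = z^*.
  apply: (@conj_of_ge0 r _ _ 0) => //; rewrite addr0.
    by have := h 1; rewrite rmorph1 !mul1r.
  by have := h 'i; rewrite conjCi mulNr.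
suff z0 : z = 0 by rewrite wz z0 rmorph0.
apply/eqP/negP => /negP z0.
have n0 : `|z| ^+ 2 != 0 by rewrite sqrf_eq0 normr_eq0.
(* At t = - s z^* the form takes the value r - 2 (r + 1), which is negative. *)
pose s := (r + 1) / (`|z| ^+ 2).
have rs : s^* = s.
  apply: CrealP; apply: ger0_real; rewrite divr_ge0 ?exprn_ge0//.
  by rewrite addr_ge0.
have := h (- (s * z^*)); rewrite wz rmorphN rmorphM /= conjCK rs.
have -> : r + - (s * z^*) * z + - (s * z) * z^* = r - s * `|z| ^+ 2 *+ 2.
  by rewrite normCK mulr2n; ring.
rewrite divfK// => h1.
have : r - (r + 1) *+ 2 < 0.
  rewrite subr_lt0 mulr2n -[ltLHS]addr0 -addrA ltrD2l.
  by apply: ltr_wpDl => //; rewrite ltr_wpDl.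
by move=> /(le_lt_trans h1); rewrite ltxx.
Qed.

End Scalars.

Section EuclideanForms.
Variable R : realType.
Local Notation C := R[i].
Local Open Scope sesquilinear_scope.

Lemma cdotDl n (x y z : 'cV[C]_n) : cdot (x + y) z = cdot x z + cdot y z.
Proof. exact: linearDl. Qed.
Lemma cdotDr n (x y z : 'cV[C]_n) : cdot x (y + z) = cdot x y + cdot x z.
Proof. exact: linearDr. Qed.
Lemma cdotBl n (x y z : 'cV[C]_n) : cdot (x - y) z = cdot x z - cdot y z.
Proof. exact: linearBl. Qed.
Lemma cdotBr n (x y z : 'cV[C]_n) : cdot x (y - z) = cdot x y - cdot x z.
Proof. exact: linearBr. Qed.
Lemma cdotZl n a (x y : 'cV[C]_n) : cdot (a *: x) y = a * cdot x y.
Proof. exact: linearZl_LR. Qed.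
Lemma cdotZr n a (x y : 'cV[C]_n) : cdot x (a *: y) = a^* * cdot x y.
Proof. exact: linearZr_LR. Qed.
Lemma cdot0l n (x : 'cV[C]_n) : cdot 0 x = 0.
Proof. exact: linear0l. Qed.
Lemma cdot0r n (x : 'cV[C]_n) : cdot x 0 = 0.
Proof. exact: linear0r. Qed.
Lemma cdot_suml n (I : finType) (F : I -> 'cV[C]_n) y :
  cdot (\sum_i F i) y = \sum_i cdot (F i) y.
Proof. exact: linear_sumlz. Qed.
Lemma cdotC n (x y : 'cV[C]_n) : cdot x y = (cdot y x)^*.
Proof. by rewrite (hermC (@cdot R n)) expr0 mul1r. Qed.
Lemma cdot_ge0 n (x : 'cV[C]_n) : 0 <= cdot x x.
Proof. exact: dnorm_ge0. Qed.
Lemma cdot_eq0 n (x : 'cV[C]_n) : (cdot x x == 0) = (x == 0).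
Proof. exact: dnorm_eq0. Qed.

Lemma cdot_adj m n (A : 'M[C]_(m, n)) u v :
  cdot (A *m u) v = cdot u (A^t* *m v).
Proof.
rewrite /cdot; under eq_bigr do rewrite mxE mulr_suml.
rewrite exchange_big /=; apply: eq_bigr => j _.
rewrite mxE rmorph_sum mulr_sumr; apply: eq_bigr => i _.
by rewrite !mxE rmorphM /= conjCK mulrCA mulrA.
Qed.

Lemma adjmxM m n p (A : 'M[C]_(m, n)) (B : 'M[C]_(n, p)) :
  (A *m B)^t* = B^t* *m A^t*.
Proof. by rewrite trmx_mul map_mxM. Qed.

Lemma cdot_delta m n (A : 'M[C]_(m, n)) i j :
  cdot (A *m delta_mx j ord0) (delta_mx i ord0) = A i j.
Proof.
rewrite -colE /cdot (bigD1 i)//= big1 ?addr0 => [|k ki].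
  by rewrite !mxE !eqxx rmorph1 mulr1.
by rewrite !mxE (negPf ki) rmorph0 mulr0.
Qed.

Lemma cdot_ext m (u w : 'cV[C]_m) : (forall v, cdot u v = cdot w v) -> u = w.
Proof.
move=> h; apply/eqP; rewrite -subr_eq0 -cdot_eq0 cdotBl h.
by rewrite subrr.
Qed.

Definition psd n (A : 'M[C]_n) := forall v, 0 <= cdot (A *m v) v.

(** Positivity of the block matrix [[A, B], [B', D]], kept as a form so that no blocks are
    assembled. That B' is the adjoint of B is a consequence, [psd_block_adj]. *)
Definition psd_block m n (A : 'M[C]_m) (B : 'M[C]_(m, n)) (B' : 'M[C]_(n, m))
    (D : 'M[C]_n) :=
  forall u w, 0 <= cdot (A *m u) u + cdot (B *m w) u + cdot (B' *m u) w
                   + cdot (D *m w) w.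

Lemma psd_block_psd m n A B B' D : @psd_block m n A B B' D -> psd A /\ psd D.
Proof.
move=> h; split=> v.
  by have := h v 0; rewrite !mulmx0 !cdot0l cdot0r !addr0.
by have := h 0 v; rewrite !mulmx0 !cdot0l cdot0r !add0r.
Qed.

Lemma psd_block_adj m n A B B' D : @psd_block m n A B B' D -> B' = B^t*.
Proof.
move=> h; have [hA hD] := psd_block_psd h.
have e u w : cdot (B' *m u) w = (cdot (B *m w) u)^*.
  apply: (@conj_of_ge0 _ (cdot (A *m u) u) _ _ (cdot (D *m w) w)) => //.
  have := h u ('i *: w).
  rewrite -!scalemxAr !cdotZl !cdotZr conjCi !mulNr.
  by rewrite mulrN mulrA -expr2 sqrCi mulN1r opprK.
apply/matrixP => i j; by rewrite -cdot_delta e cdot_delta !mxE.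
Qed.

(** Replacing w by t w leaves a form affine in t, since its quadratic term vanishes;
    [affine_ge0_eq0] then kills the cross terms. *)
Lemma psd_block_eq0r m n A B B' D w : @psd_block m n A B B' D ->
  cdot (D *m w) w = 0 -> B *m w = 0.
Proof.
move=> h w0; apply: cdot_ext => u; rewrite cdot0l.
have [] // := @affine_ge0_eq0 C (cdot (A *m u) u) (cdot (B *m w) u)
  (cdot (B' *m u) w) _.
move=> t; have := h u (t *: w).
by rewrite -!scalemxAr !cdotZl !cdotZr w0 !mulr0 addr0.
Qed.

Lemma psd_block_sym m n A B B' D :
  @psd_block m n A B B' D -> psd_block D B' B A.
Proof.
move=> h u w; have := h w u; congr (0 <= _).
by ring.
Qed.

Lemma psd_diag_block n (A : 'M[C]_n) : psd A -> psd_block A A A A.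
Proof.
by move=> h u w; have := h (u + w); rewrite mulmxDr cdotDl !cdotDr; congr (0 <= _); ring.
Qed.

Lemma psd_adj n (A : 'M[C]_n) : psd A -> A^t* = A.
Proof. by move=> /psd_diag_block/psd_block_adj. Qed.

Lemma psd_eq0 n (A : 'M[C]_n) w : psd A -> cdot (A *m w) w = 0 -> A *m w = 0.
Proof. by move=> /psd_diag_block/psd_block_eq0r; apply. Qed.

End EuclideanForms.

(** * Domination between positive semidefinite matrices *)

Section Domination.
Variable R : realType.
Local Notation C := R[i].
Local Open Scope sesquilinear_scope.

Lemma form_bound n (A : 'M[C]_n) :
  exists2 c : C, 0 < c & forall v, `|cdot (A *m v) v| <= c * cdot v v.
Proof.
exists (1 + \sum_i \sum_j `|A i j|).
  by rewrite ltr_wpDr// sumr_ge0// => i _; rewrite sumr_ge0.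
move=> v; rewrite mulrDl mul1r ler_wpDl ?cdot_ge0// mulr_suml /cdot.
apply: (le_trans (ler_norm_sum _ _ _)); apply: ler_sum => i _.
rewrite mxE !mulr_suml; apply: (le_trans (ler_norm_sum _ _ _)).
apply: ler_sum => j _; rewrite !normrM norm_conjC -mulrA ler_wpM2l//.
have -> : \sum_k v k ord0 * (v k ord0)^* = `|v : euclid R n| ^+ 2.
  by rewrite -inner_norm.
by rewrite expr2; apply: ler_pM => //; exact: euclid_coord_le.
Qed.

(** Expand the form of P at v - c^-1 P v, with c a bound for the form of P: the term c^-2 <P P v, P
    v> is at most c^-1 <P v, P v>. *)
Lemma psd_sqr_bound n (P : 'M[C]_n) : psd P ->
  exists2 c : C, 0 < c &
    forall v, cdot (P *m v) (P *m v) <= c * cdot (P *m v) v.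
Proof.
move=> hP; have [c c0 hc] := form_bound P; exists c => // v.
have cR : (c^-1)^* = c^-1 by apply: CrealP; rewrite realV gtr0_real.
have sym : cdot (P *m (P *m v)) v = cdot (P *m v) (P *m v).
  by rewrite [LHS]cdot_adj psd_adj.
have := hP (v - c^-1 *: (P *m v)).
rewrite mulmxBr -scalemxAr cdotBl !cdotBr !cdotZl !cdotZr cR sym => h.
have := hc (P *m v); rewrite ger0_norm; last exact: hP.
set q := cdot (P *m (P *m v)) (P *m v) in h *.
set p := cdot (P *m v) v in h *; set s := cdot (P *m v) (P *m v) in h * => hq.
rewrite -ler_pdivrMl// -subr_ge0; apply: (le_trans h).
rewrite -subr_ge0; have -> : p - c^-1 * s - (p - c^-1 * s - (c^-1 * s - c^-1 * (c^-1 * q))) =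
   c^-1 * (c^-1 * (c * s - q)).
  by rewrite mulrBr mulKf ?gt_eqF//; ring.
by rewrite !mulr_ge0 ?invr_ge0 ?subr_ge0 // ltW.
Qed.

Lemma submx_cV (F : fieldType) m p n (A : 'M[F]_(m, n)) (B : 'M[F]_(p, n)) :
  (forall v : 'cV_n, B *m v = 0 -> A *m v = 0) -> (A <= B)%MS.
Proof.
move=> h; rewrite submxE; apply/eqP/matrixP => i j.
have -> : (A *m cokermx B) i j = (A *m col j (cokermx B)) i ord0.
  by rewrite [LHS]mxE [RHS]mxE; apply: eq_bigr => k _; rewrite [in RHS]mxE.
rewrite h; first by rewrite !mxE.
by rewrite colE mulmxA mulmx_coker mul0mx.
Qed.

(** The kernel inclusion factors Q as P Z P, so <Q v, v> = <Z P v, P v> is at most c1 |P v|^2, which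
    is at most c1 c2 <P v, v>. *)
Lemma psd_dominated n (P Q : 'M[C]_n) : psd P -> psd Q ->
  (forall v : 'cV_n, P *m v = 0 -> Q *m v = 0) ->
  exists c : C, psd (c *: P - Q).
Proof.
move=> hP hQ /submx_cV QP; pose Y := Q *m pinvmx P.
have QE : Q = P *m (Y^t* *m pinvmx P) *m P.
  have PY : P *m Y^t* = Q by rewrite -{1}(psd_adj hP) -adjmxM mulmxKpV// psd_adj.
  by rewrite mulmxA PY mulmxKpV.
have [c1 c10 h1] := form_bound (Y^t* *m pinvmx P).
have [c2 c20 h2] := psd_sqr_bound hP.
exists (c1 * c2) => v.
rewrite mulmxBl -scalemxAl cdotBl cdotZl subr_ge0.
rewrite -(ger0_norm (hQ v)) {1}QE -mulmxA -mulmxA cdot_adj (psd_adj hP).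
by apply: (le_trans (h1 _)); rewrite -mulrA ler_wpM2l// ltW.
Qed.

End Domination.

(** * Matrices supported on a graph *)

Section Pattern.
Variables (R : realType) (d : nat) (G : sgraph d).
Local Notation C := R[i].
Local Open Scope sesquilinear_scope.

Lemma adjeq_refl i : adjeq G i i.
Proof. by rewrite /adjeq /= eqxx orbT. Qed.

Lemma adjeq_sym i j : adjeq G i j = adjeq G j i.
Proof. by rewrite /adjeq /= adj_sym eq_sym. Qed.

Definition supported (A : 'M[C]_d) := forall i j, A i j != 0 -> adjeq G i j.

Lemma supported0 : supported 0.
Proof. by move=> i j; rewrite mxE eqxx. Qed.

Lemma supported_lin a A B :
  supported A -> supported B -> supported (a *: A + B).
Proof.
move=> hA hB i j; rewrite !mxE; have [/eqP A0|/hA//] := boolP (A i j == 0).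
by rewrite A0 mulr0 add0r => /hB.
Qed.

Lemma supportedD A B : supported A -> supported B -> supported (A + B).
Proof. by move=> hA hB; rewrite -[A]scale1r; exact: supported_lin. Qed.

Lemma supportedZ a A : supported A -> supported (a *: A).
Proof.
by move=> hA; rewrite -[_ *: _]addr0; apply: supported_lin => //; exact: supported0.
Qed.

Lemma supported_sum (I : Type) (r : seq I) (P : pred I) (F : I -> 'M_d) :
  (forall i, P i -> supported (F i)) -> supported (\sum_(i <- r | P i) F i).
Proof. by move=> h; apply: big_ind => //; [exact: supported0|exact: supportedD]. Qed.

Lemma supported_delta i j : adjeq G i j -> supported (delta_mx i j).
Proof.
move=> h k l; rewrite mxE.
by have [->|_] := eqVneq k i; have [->|_] := eqVneq l j; rewrite /= ?eqxx.
Qed.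

Lemma supported_scalar a : supported (a%:M).
Proof.
move=> k l; rewrite mxE; have [->|_] := eqVneq k l; last by rewrite mulr0n eqxx.
by move=> _; exact: adjeq_refl.
Qed.

Lemma supported_adj A : supported A -> supported (A^t*).
Proof. by move=> h i j; rewrite !mxE conjC_eq0 adjeq_sym => /h. Qed.

Definition linear_on (V : lmodType C) (f : 'M[C]_d -> V) :=
  forall a A B, supported A -> supported B -> f (a *: A + B) = a *: f A + f B.

Variables (V : lmodType C) (f : 'M[C]_d -> V).
Hypothesis fl : linear_on f.

Lemma linear_on0 : f 0 = 0.
Proof.
have := fl 1 supported0 supported0; rewrite !scale1r addr0 => e.
by apply: (addIr (f 0)); rewrite -e add0r.
Qed.

Lemma linear_onZ a A : supported A -> f (a *: A) = a *: f A.
Proof. by move=> hA; have := fl a hA supported0; rewrite linear_on0 !addr0. Qed.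

Lemma linear_onD A B : supported A -> supported B -> f (A + B) = f A + f B.
Proof. by move=> hA hB; have := fl 1 hA hB; rewrite !scale1r. Qed.

Lemma linear_on_sum (I : Type) (r : seq I) (P : pred I) (F : I -> 'M_d) :
  (forall i, P i -> supported (F i)) ->
  f (\sum_(i <- r | P i) F i) = \sum_(i <- r | P i) f (F i).
Proof.
move=> h; suff [] : f (\sum_(i <- r | P i) F i) = \sum_(i <- r | P i) f (F i)
  /\ supported (\sum_(i <- r | P i) F i) by [].
apply: (big_rec2 (fun (x : V) y => f y = x /\ supported y)).
  by split; [exact: linear_on0|exact: supported0].
move=> i x y Pi [<- hy]; have hi := h i Pi.
by rewrite linear_onD//; split => //; exact: supportedD.
Qed.

(** The sum runs over all pairs: the uncontrolled values of [f] at non-edges carry zero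
    coefficients. *)
Lemma linear_on_delta A : supported A ->
  f A = \sum_i \sum_j A i j *: f (delta_mx i j).
Proof.
move=> hA; rewrite {1}[A]matrix_sum_delta.
have hs i j : supported (A i j *: delta_mx i j).
  have [->|/hA h] := eqVneq (A i j) 0; first by rewrite scale0r; exact: supported0.
  by apply: supportedZ; exact: supported_delta.
rewrite linear_on_sum => [|i _]; last by apply: supported_sum.
apply: eq_bigr => i _; rewrite linear_on_sum //; apply: eq_bigr => j _.
have [->|/hA h] := eqVneq (A i j) 0; first by rewrite !scale0r linear_on0.
by rewrite linear_onZ//; exact: supported_delta.
Qed.

End Pattern.

(** * Order embeddings between graph operator systems *)

Section OrderEmbedding.
Variables (R : realType) (d N : nat) (G : sgraph d).
Local Notation C := R[i].
Local Open Scope sesquilinear_scope.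
Variable Psi : 'M[C]_d -> 'M[C]_N.
Hypothesis Psi_lin : linear_on G Psi.
Hypothesis Psi_refl : forall A, supported G A -> psd (Psi A) -> psd A.
Hypothesis Psi_block : forall k l, adjeq G k l ->
  psd_block (Psi (delta_mx k k)) (Psi (delta_mx k l))
            (Psi (delta_mx l k)) (Psi (delta_mx l l)).

Let sdelta k : supported G (delta_mx k k : 'M[C]_d).
Proof. by apply: supported_delta; exact: adjeq_refl. Qed.

Let Psi_psd k : psd (Psi (delta_mx k k)).
Proof. by have [] := psd_block_psd (Psi_block (adjeq_refl G k)). Qed.

(* If ker (Psi P) were contained in ker (Psi 1), where P = 1 - E_kk, then Psi P
   would dominate a multiple of Psi 1, so c P >= 1, false at the (k, k) entry. *)
Lemma peak_vector k : exists v : 'cV[C]_N,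
  Psi (delta_mx k k) *m v != 0 /\
  forall l, l != k -> Psi (delta_mx l l) *m v = 0.
Proof.
pose P : 'M[C]_d := \sum_(l | l != k) delta_mx l l.
have sP : supported G P by apply: supported_sum.
have PE : Psi P = \sum_(l | l != k) Psi (delta_mx l l) by rewrite (linear_on_sum Psi_lin).
have I1 : (1%:M : 'M[C]_d) = delta_mx k k + P by rewrite mx1_sum_delta (bigD1 k).
have s1 := @supported_scalar R d G 1.
have cP v : cdot (Psi P *m v) v =
    \sum_(l | l != k) cdot (Psi (delta_mx l l) *m v) v.
  rewrite PE mulmx_suml; elim/big_rec2: _ => [|l x y _ <-]; first by rewrite cdot0l.
  by rewrite cdotDl.
have hP : psd (Psi P) by move=> v; rewrite cP sumr_ge0// => l _; exact: Psi_psd.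
have h1 : psd (Psi 1%:M).
  move=> v; rewrite I1 (linear_onD Psi_lin)// mulmxDl cdotDl addr_ge0//.
  exact: Psi_psd.
have [v [Pv hv]] : exists v : 'cV_N, Psi P *m v = 0 /\ Psi 1%:M *m v != 0.
  apply: contrapT => /forallNP no.
  have [|c] := psd_dominated hP h1.
    by move=> v Pv; apply/eqP/negPn/negP => hv; exact: (no v).
  rewrite -scaleN1r -(linear_onZ Psi_lin)// -(linear_onZ Psi_lin)//.
  rewrite -(linear_onD Psi_lin); try exact: supportedZ.
  have sc : supported G (c *: P + -1 *: 1%:M) by apply: supportedD; exact: supportedZ.
  move/Psi_refl => /(_ sc (delta_mx k ord0)); rewrite cdot_delta !mxE eqxx.
  rewrite summxE big1 => [|l lk]; last by rewrite !mxE eq_sym (negPf lk).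
  by rewrite mulr0 add0r mulr1 ler0N1.
have Fl l : l != k -> Psi (delta_mx l l) *m v = 0.
  move=> lk; apply: psd_eq0 => //.
  have /eqP := cP v; rewrite Pv cdot0l eq_sym psumr_eq0 => [/allP|j _]; last exact: Psi_psd.
  by move=> /(_ l); rewrite mem_index_enum lk => /(_ isT)/eqP.
exists v; split => //; move: hv; apply: contra => /eqP Fk.
by rewrite I1 (linear_onD Psi_lin)// mulmxDl Fk Pv addr0.
Qed.

(** The columns are peak vectors. Applying Psi E_ll to a linear relation among them isolates its
    l-th coefficient, so they are independent. *)
Lemma peak_family : exists V : 'M[C]_(N, d), row_free V^T /\
  forall l k, l != k -> Psi (delta_mx l l) *m col k V = 0.
Proof.
have [v hv] := choice peak_vector.
pose V : 'M[C]_(N, d) := \matrix_(i, k) v k i ord0.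
have colV k : col k V = v k by apply/matrixP => i j; rewrite !mxE (ord1 j).
exists V; split; last by move=> l k lk; rewrite colV; exact: (hv k).2.
apply: inj_row_free => a aV.
have e : V *m a^T = 0 by rewrite -[V]trmxK -trmx_mul aV trmx0.
apply/rowP => l; rewrite [RHS]mxE.
have : Psi (delta_mx l l) *m (V *m a^T) = 0 by rewrite e mulmx0.
have -> : V *m a^T = \sum_k a 0 k *: v k.
  apply/matrixP => i j; rewrite mxE summxE; apply: eq_bigr => k _.
  by rewrite !mxE mulrC ord1.
rewrite mulmx_sumr (bigD1 l)//= big1 => [|k kl]; last first.
  by rewrite -scalemxAr (hv k).2 1?eq_sym// scaler0.
move/eqP; rewrite addr0 -scalemxAr scaler_eq0 (negPf (hv l).1) orbF.
by move/eqP.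
Qed.

Lemma order_embedding_leq : (d <= N)%N.
Proof.
by have [V [/eqP e _]] := peak_family; have := rank_leq_col V^T; rewrite e.
Qed.

End OrderEmbedding.

Section SquareOrderEmbedding.
Variables (R : realType) (d : nat) (G H : sgraph d).
Local Notation C := R[i].
Local Open Scope sesquilinear_scope.
Variable Psi : 'M[C]_d -> 'M[C]_d.
Hypothesis Psi_lin : linear_on G Psi.
Hypothesis Psi_refl : forall A, supported G A -> psd (Psi A) -> psd A.
Hypothesis Psi_block : forall k l, adjeq G k l ->
  psd_block (Psi (delta_mx k k)) (Psi (delta_mx k l))
            (Psi (delta_mx l k)) (Psi (delta_mx l l)).
Hypothesis Psi_supp : forall A, supported G A -> supported H (Psi A).

(** If the image were 0, reflection would make both E_kl and - E_kl positive, forcing E_kl = 0. *)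
Lemma order_embedding_delta_neq0 k l : adjeq G k l -> Psi (delta_mx k l) != 0.
Proof.
move=> kl; apply/eqP => X0; have s := @supported_delta R d G k l kl.
have p1 : psd (delta_mx k l : 'M[C]_d).
  by apply: Psi_refl => // v; rewrite X0 mul0mx cdot0l.
have p2 : psd (- delta_mx k l : 'M[C]_d).
  rewrite -scaleN1r; apply: Psi_refl; first exact: supportedZ.
  by rewrite (linear_onZ Psi_lin)// X0 scaler0 => v; rewrite mul0mx cdot0l.
have h v : delta_mx k l *m v = 0 :> 'cV[C]_d.
  apply: psd_eq0 => //; apply/eqP; rewrite eq_le p1 andbT.
  by have := p2 v; rewrite mulNmx -scaleN1r cdotZl mulN1r oppr_ge0.
have := cdot_delta (delta_mx k l : 'M[C]_d) k l.
by rewrite h cdot0l mxE !eqxx => /esym/eqP; rewrite oner_eq0.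
Qed.

Lemma order_embedding_perm : exists s : 'S_d,
  forall k l, adjeq G k l -> adjeq H (s k) (s l).
Proof.
have [V [Vfree FV]] := peak_family Psi_lin Psi_refl Psi_block.
have Vu : V \in unitmx by rewrite -unitmx_tr -row_free_unit.
pose W := invmx V.
have : \det W != 0 by rewrite -unitfE -unitmxE unitmx_inv.
(* Some term of the Leibniz expansion of det W is nonzero. *)
move=> dW; have [s hs] : exists s : 'S_d, \prod_i W i (s i) != 0.
  apply: contrapT => /forallNP no; move: dW; rewrite /determinant big1 ?eqxx// => s _.
  by have /negP/negPn/eqP -> := no s; rewrite mulr0.
have {}hs i : W i (s i) != 0 by move/prodf_neq0: hs; apply.
exists s => k l kl; have blk := Psi_block kl.
set X := Psi (delta_mx k l) in blk.
have XV j : j != l -> X *m col j V = 0.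
  move=> jl; apply: (psd_block_eq0r blk).
  by rewrite FV ?cdot0l// eq_sym.
have X'V j : j != k -> X^t* *m col j V = 0.
  rewrite -(psd_block_adj blk) => jk; apply: (psd_block_eq0r (psd_block_sym blk)).
  by rewrite FV ?cdot0l// eq_sym.
(* X kills every column of V but the l-th and X^* every column but the k-th, so only the (k, l)
   entry of Y survives. *)
pose Y := V^t* *m X *m V.
have YE : Y = Y k l *: delta_mx k l.
  have Z0 (Z : 'M[C]_d) a b : Z *m col b V = 0 -> (V^t* *m Z *m V) a b = 0.
    by move=> Zb; rewrite -cdot_delta -!mulmxA -colE Zb mulmx0 cdot0l.
  apply/matrixP => a b; rewrite [RHS]mxE [X in _ * X]mxE.
  have [->|bl] := eqVneq b l; last first.
    by rewrite andbF mulr0 Z0 // XV.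
  have [->|ak] := eqVneq a k; first by rewrite mulr1.
  rewrite mulr0; have := Z0 (X^t*) l a (X'V a ak).
  have -> : V^t* *m X^t* *m V = Y^t* by rewrite /Y !adjmxM trmxCK mulmxA.
  by rewrite mxE [X in X^*]mxE => /eqP; rewrite conjC_eq0 => /eqP.
have XE : X = W^t* *m Y *m W.
  rewrite /Y !mulmxA -adjmxM mulmxV// trmx1 map_mx1 mul1mx -mulmxA mulmxV//.
  by rewrite mulmx1.
apply: (Psi_supp (supported_delta kl)).
have X0 : X != 0 := order_embedding_delta_neq0 kl.
have ykl : Y k l != 0.
  by apply: contra X0 => /eqP y0; rewrite XE YE y0 scale0r mulmx0 mul0mx.
(* The (s k, s l) entry of X = W^* Y W is the product of Y_kl, the conjugate of W_(k, s k), and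
   W_(l, s l). *)
rewrite -/X XE YE -scalemxAr -scalemxAl mxE mulf_neq0//.
rewrite -(mul_delta_mx (0 : 'I_1)) -!mulmxA mulmxA -colE -rowE mxE big_ord1.
by rewrite !mxE mulf_neq0// conjC_eq0.
Qed.

End SquareOrderEmbedding.

(** * Operators on Hilbert spaces *)

Section Hilbert.
Variable R : realType.
Local Notation C := R[i].
Implicit Types L K : hilbertType R.

Lemma innerDl L (x y z : L) : inner (x + y) z = inner x z + inner y z.
Proof. exact: linearDl. Qed.
Lemma innerDr L (x y z : L) : inner x (y + z) = inner x y + inner x z.
Proof. exact: linearDr. Qed.
Lemma innerNl L (x y : L) : inner (- x) y = - inner x y.
Proof. exact: linearNl. Qed.
Lemma innerNr L (x y : L) : inner x (- y) = - inner x y.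
Proof. exact: linearNr. Qed.
Lemma innerZl L a (x y : L) : inner (a *: x) y = a * inner x y.
Proof. exact: linearZl_LR. Qed.
Lemma innerZr L a (x y : L) : inner x (a *: y) = a^* * inner x y.
Proof. exact: linearZr_LR. Qed.
Lemma inner0l L (x : L) : inner 0 x = 0.
Proof. exact: linear0l. Qed.
Lemma inner_suml L (I : Type) (r : seq I) (P : pred I) (F : I -> L) y :
  inner (\sum_(i <- r | P i) F i) y = \sum_(i <- r | P i) inner (F i) y.
Proof. exact: linear_sumlz. Qed.
Lemma inner_sumr L (I : Type) (r : seq I) (P : pred I) (F : I -> L) y :
  inner y (\sum_(i <- r | P i) F i) = \sum_(i <- r | P i) inner y (F i).
Proof. exact: linear_sumr. Qed.
Lemma innerC L (x y : L) : inner x y = (inner y x)^*.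
Proof. by rewrite (hermC (@inner R L)) expr0 mul1r. Qed.
Lemma inner_ge0 L (x : L) : 0 <= inner x x.
Proof. by rewrite inner_norm exprn_ge0. Qed.
Lemma inner_eq0 L (x : L) : inner x x = 0 -> x = 0.
Proof. by rewrite inner_norm => /eqP; rewrite sqrf_eq0 normr_eq0 => /eqP. Qed.

Lemma inner_ext L (x y : L) : (forall z, inner x z = inner y z) -> x = y.
Proof.
move=> h; apply/eqP; rewrite -subr_eq0; apply/eqP/inner_eq0.
by rewrite innerDl innerNl h subrr.
Qed.

Lemma inner_cauchy_schwarz L (x y : L) : `|inner x y| <= `|x| * `|y|.
Proof.
have [->|y0] := eqVneq y 0; first by rewrite normr0 mulr0 innerC inner0l rmorph0 normr0.
have n0 : 0 < `|y| ^+ 2 by rewrite exprn_gt0// normr_gt0.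
rewrite -ler_sqr ?nnegrE ?mulr_ge0// exprMn -ler_pdivrMr//.
pose t := inner x y / `|y| ^+ 2.
have := inner_ge0 (x - t *: y).
rewrite innerDl !innerDr !innerNl !innerNr !innerZr !innerZl !inner_norm.
have rn : (`|y| ^- 2)^* = `|y| ^- 2.
  by apply: CrealP; rewrite realV gtr0_real.
have -> : t^* = (inner x y)^* / `|y| ^+ 2 by rewrite rmorphM /= rn.
rewrite (innerC y x) => h; rewrite -subr_ge0 normCK; move: h.
by congr (0 <= _); rewrite /t; field; rewrite normr_eq0.
Qed.

Section LinearFunctions.
Variables (U V : lmodType C) (f : U -> V).
Hypothesis fl : linear f.

Lemma linear_funD x y : f (x + y) = f x + f y.
Proof. by have := fl 1 x y; rewrite !scale1r. Qed.
Lemma linear_fun0 : f 0 = 0.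
Proof. by apply: (addIr (f 0)); rewrite -linear_funD !add0r. Qed.
Lemma linear_funZ a x : f (a *: x) = a *: f x.
Proof. by have := fl a x 0; rewrite linear_fun0 !addr0. Qed.
Lemma linear_funN x : f (- x) = - f x.
Proof. by rewrite -scaleN1r linear_funZ scaleN1r. Qed.
Lemma linear_fun_sum (I : Type) (r : seq I) (P : pred I) (F : I -> U) :
  f (\sum_(i <- r | P i) F i) = \sum_(i <- r | P i) f (F i).
Proof. by apply: (big_morph f linear_funD linear_fun0). Qed.
End LinearFunctions.

Lemma bounded_op_bound L K (T : L -> K) : bounded_op T ->
  exists2 c : C, 0 < c & forall x, `|T x| <= c * `|x|.
Proof.
move=> [Tl Tc].
pose g : {linear L -> K} := HB.pack T (GRing.isLinear.Build _ _ _ _ T Tl).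
have /linear_bounded_continuous/linear_boundedP : continuous g by [].
move=> [M [Mr hM]]; exists (`|M| + 1); first by rewrite ltr_wpDl.
apply: hM; apply: (le_lt_trans (real_ler_norm Mr)).
by rewrite ltrDl.
Qed.

Lemma bounded_op_comp L K (H : hilbertType R) (S : K -> H) (T : L -> K) :
  bounded_op S -> bounded_op T -> bounded_op (S \o T).
Proof.
move=> [Sl Sc] [Tl Tc]; split; first by move=> a x y /=; rewrite Tl Sl.
by move=> x; apply: continuous_comp; [exact: Tc|exact: Sc].
Qed.

Definition adjoint_pair L K (T : L -> K) (T' : K -> L) :=
  [/\ linear T, linear T' & forall x y, inner (T x) y = inner x (T' y)].

Lemma adjoint_pair_sym L K (T : L -> K) (T' : K -> L) :
  adjoint_pair T T' -> adjoint_pair T' T.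
Proof. by move=> [h1 h2 h]; split=> // x y; rewrite innerC -h -innerC. Qed.

(** Frees matrix positivity from ordinal indices, so that blocks can be indexed by [bool] or by
    pairs. *)
Lemma mx_pos_fin (H : hilbertType R) (I : finType) (A : I -> I -> (H -> H)) :
  mx_pos (\matrix_(i, j) A (enum_val i) (enum_val j) : 'M_#|I|) <->
  forall xi : I -> H, 0 <= \sum_i \sum_j inner (A i j (xi j)) (xi i).
Proof.
have re (xi : I -> H) : \sum_i \sum_j inner (A i j (xi j)) (xi i) =
    \sum_(i < #|I|) \sum_(j < #|I|) inner ((\matrix_(i, j) A (enum_val i) (enum_val j)) i j
       (xi (enum_val j))) (xi (enum_val i)).
  rewrite (reindex (@enum_val I I)) /=; last by apply: onW_bij; exact: enum_val_bij.
  apply: eq_bigr => i _.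
  rewrite (reindex (@enum_val I I)) /=; last by apply: onW_bij; exact: enum_val_bij.
  by apply: eq_bigr => j _; rewrite mxE.
split => [h xi|h xi]; first by rewrite re; exact: (h (xi \o enum_val)).
have := h (xi \o enum_rank); rewrite re; congr (0 <= _).
by apply: eq_bigr => i _; apply: eq_bigr => j _; rewrite /= !enum_valK.
Qed.

End Hilbert.

Section GraphOpsys.
Variables (R : realType) (d : nat) (G : sgraph d).
Local Notation C := R[i].

Lemma mx_op_lin a (A B : 'M[C]_d) : mx_op (a *: A + B) = a *: mx_op A + mx_op B.
Proof. by apply/funext => x; rewrite /mx_op mulmxDl -scalemxAl. Qed.

Lemma mx_op1 : mx_op (1%:M : 'M[C]_d) = id.
Proof. by apply/funext => x; rewrite /mx_op mul1mx. Qed.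

Lemma linspan_lin (V : lmodType C) (X : set V) a x y :
  X x -> linspan X y -> linspan X (a *: x + y).
Proof.
move=> hx [n [c [u [hu ->]]]].
exists n.+1, (fun i => oapp c a (unlift ord0 i)), (fun i => oapp u x (unlift ord0 i)).
split; first by move=> i; case: unliftP => [j _|_] /=.
rewrite big_ord_recl unlift_none /=; congr (_ + _).
by apply: eq_bigr => i _; rewrite liftK.
Qed.

Lemma linspan0 (V : lmodType C) (X : set V) : linspan X 0.
Proof. by exists 0%N, (fun=> 0), (fun=> 0); split => [[]|]; rewrite ?big_ord0. Qed.

Lemma linspan_sum (V : lmodType C) (X : set V) (I : Type) (r : seq I) (P : pred I)
    (c : I -> C) (u : I -> V) :
  (forall i, P i -> c i != 0 -> X (u i)) ->
  linspan X (\sum_(i <- r | P i) c i *: u i).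
Proof.
move=> h; elim: r => [|i r IH]; first by rewrite big_nil; exact: linspan0.
rewrite big_cons; case: ifP => // Pi.
have [->|ci] := eqVneq (c i) 0; first by rewrite scale0r add0r.
by apply: linspan_lin => //; exact: h.
Qed.

Lemma graph_opsysP (T : euclid R d -> euclid R d) :
  graph_opsys R G T <-> exists2 A, supported G A & T = mx_op A.
Proof.
split=> [[A [n [c [u [hu ->]]]] <-]|[A hA ->]].
  exists (\sum_i c i *: u i) => //; apply: supported_sum => i _.
  apply: supportedZ; have [k [l [kl ->]]] := hu i; exact: supported_delta.
exists A => //; rewrite [A]matrix_sum_delta pair_big /=.
apply: linspan_sum => -[i j] _ /= Aij; exists i, j; split=> //; exact: hA.
Qed.

End GraphOpsys.

(** * Complete order embeddings of graph operator systems *)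

Section Embedding.
Variables (R : realType) (d : nat) (G : sgraph d) (L : hilbertType R).
Local Notation C := R[i].
Local Open Scope sesquilinear_scope.
Variable phi : (euclid R d -> euclid R d) -> (L -> L).
Hypothesis uco : unital_complete_order_embedding (graph_opsys R G) phi.

Definition rep (A : 'M[C]_d) : L -> L := phi (mx_op A).

Let opA A : supported G A -> graph_opsys R G (mx_op A).
Proof. by move=> hA; apply/graph_opsysP; exists A. Qed.

Lemma rep_lin : linear_on G rep.
Proof.
have [_ h _ _ _] := uco; move=> a A B hA hB.
by rewrite /rep mx_op_lin h//; exact: opA.
Qed.

Lemma rep1 : rep 1%:M = id.
Proof. by have [_ _ h _ _] := uco; rewrite /rep mx_op1. Qed.

Lemma rep_bounded A : supported G A -> bounded_op (rep A).
Proof. by have [h _ _ _ _] := uco; move=> hA; apply: h; exact: opA. Qed.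

Lemma rep_linear A : supported G A -> linear (rep A).
Proof. by move=> /rep_bounded[]. Qed.

Lemma rep_inj A B : supported G A -> supported G B -> rep A = rep B -> A = B.
Proof.
have [_ _ _ h _] := uco => hA hB /(h _ _ (opA hA) (opA hB)) e.
apply/matrixP => i j; rewrite -cdot_delta -[RHS]cdot_delta.
by have := congr1 (fun f : euclid R d -> euclid R d => f (delta_mx j ord0)) e;
  rewrite /mx_op => ->.
Qed.

Lemma rep_pos (I : finType) (A : I -> I -> 'M[C]_d) :
  (forall i j, supported G (A i j)) ->
  (forall xi : I -> 'cV[C]_d, 0 <= \sum_i \sum_j cdot (A i j *m xi j) (xi i)) <->
  (forall xi : I -> L, 0 <= \sum_i \sum_j inner (rep (A i j) (xi j)) (xi i)).
Proof.
move=> hA; have [_ _ _ _ h] := uco.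
pose T : 'M[euclid R d -> euclid R d]_#|I| :=
  \matrix_(i, j) mx_op (A (enum_val i) (enum_val j)).
have hT i j : graph_opsys R G (T i j) by rewrite mxE; exact: opA.
have [h1 h2] := h _ T hT.
have e : map_mx phi T = \matrix_(i, j) rep (A (enum_val i) (enum_val j)).
  by apply/matrixP => i j; rewrite !mxE.
rewrite e in h1 h2.
have p1 := mx_pos_fin (fun i j => rep (A i j)).
have p2 := mx_pos_fin (fun i j => @mx_op R d (A i j)).
split=> [H|H].
  by apply/p1/h1/p2 => xi; exact: H.
by have := h2 (p1.2 H) => /p2.
Qed.

Lemma rep_psd A : supported G A -> (psd A <-> forall x, 0 <= inner (rep A x) x).
Proof.
move=> hA; have [h1 h2] := @rep_pos 'I_1 (fun _ _ => A) (fun _ _ => hA).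
split=> [h x|h v].
  have := h1 _ (fun=> x); rewrite !big_ord1; apply => xi.
  by rewrite !big_ord1.
by have := h2 _ (fun=> v); rewrite !big_ord1; apply => xi; rewrite !big_ord1.
Qed.

Local Notation E i j := (rep (delta_mx i j)).

Lemma delta_form (i j : 'I_d) (u w : 'cV[C]_d) :
  cdot (delta_mx i j *m w) u = w j ord0 * (u i ord0)^*.
Proof.
rewrite /cdot (bigD1 i)//= big1 ?addr0 => [|k ki].
  rewrite mxE (bigD1 j)//= big1 ?addr0 ?mxE ?eqxx ?mul1r// => k kj.
  by rewrite mxE eqxx (negPf kj) mul0r.
by rewrite mxE big1 ?mul0r// => l _; rewrite mxE (negPf ki) mul0r.
Qed.

(** The form is |u_i + w_j|^2. *)
Lemma delta_block (i j : 'I_d) : psd_block (delta_mx i i : 'M[C]_d) (delta_mx i j)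
  (delta_mx j i) (delta_mx j j).
Proof.
move=> u w; rewrite !delta_form.
have := mul_conjC_ge0 (u i ord0 + w j ord0); congr (0 <= _).
by rewrite rmorphD /=; ring.
Qed.

Lemma psd_block_rep A B B' D : supported G A -> supported G B ->
  supported G B' -> supported G D ->
  psd_block A B B' D <-> forall x y, 0 <= inner (rep A x) x + inner (rep B y) x
     + inner (rep B' x) y + inner (rep D y) y.
Proof.
move=> hA hB hB' hD.
pose M (s t : bool) := if s then if t then A else B else if t then B' else D.
have hM s t : supported G (M s t) by case: s t => -[].
have [h1 h2] := rep_pos hM; split=> [h x y|h u w].
  have := h1 _ (fun s => if s then x else y); rewrite !big_bool /= addrA; apply => xi.
  by rewrite !big_bool /= addrA.
have := h2 _ (fun s => if s then u else w); rewrite !big_bool /= addrA; apply => xi.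
by rewrite !big_bool /= addrA.
Qed.

Lemma rep_delta_block i j : adjeq G i j ->
  forall x y, 0 <= inner (E i i x) x + inner (E i j y) x
     + inner (E j i x) y + inner (E j j y) y.
Proof.
move=> ij; apply/psd_block_rep; try exact: delta_block;
  by apply: supported_delta; rewrite // ?adjeq_refl// adjeq_sym.
Qed.

Lemma rep_delta_ge0 i x : 0 <= inner (E i i x) x.
Proof.
apply: (rep_psd _).1 => [|v]; first exact: supported_delta (adjeq_refl _ _).
by rewrite delta_form mul_conjC_ge0.
Qed.

(** An embedding is not assumed to respect adjoints; positivity of the 2 x 2 block of matrix units
    forces it to. *)
Lemma rep_delta_adj i j x y : adjeq G i j -> inner (E j i x) y = inner x (E i j y).
Proof.
move=> ij; rewrite (innerC x); apply: (@conj_of_ge0 _ (inner (E i i x) x) _ _ (inner (E j j y) y));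
  rewrite ?rep_delta_ge0//; first exact: rep_delta_block.
have := rep_delta_block ij x ('i *: y).
have [l1 l2] : linear (E i j) /\ linear (E j j).
  by split; apply: rep_linear; apply: supported_delta; rewrite ?adjeq_refl.
rewrite (linear_funZ l1) (linear_funZ l2) !innerZl !innerZr conjCi.
by rewrite !mulNr mulrN mulrA -expr2 sqrCi mulN1r opprK.
Qed.

Lemma rep_adj A x y : supported G A ->
  inner (rep A x) y = inner x (rep (A^t*) y).
Proof.
move=> hA.
have sum_fun (F : 'I_d -> L -> L) z : (\sum_i F i) z = \sum_i F i z by rewrite fct_sumE.
rewrite (linear_on_delta rep_lin hA) (linear_on_delta rep_lin (supported_adj hA)).
rewrite !sum_fun inner_suml inner_sumr.
under eq_bigr do rewrite sum_fun inner_suml.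
under [RHS]eq_bigr do rewrite sum_fun inner_sumr.
rewrite exchange_big /=; apply: eq_bigr => j _; apply: eq_bigr => i _.
rewrite innerZl innerZr !mxE conjCK.
have [->|/hA Aij] := eqVneq (A i j) 0; first by rewrite !mul0r.
by rewrite (@rep_delta_adj j i) 1?adjeq_sym.
Qed.

Lemma rep_adjr A x y : supported G A ->
  inner (rep (A^t*) x) y = inner x (rep A y).
Proof. by move=> hA; rewrite innerC -rep_adj// -innerC. Qed.

(** Evaluate the positive 2 x 2 block at (- X, y), where X = rep E_ij y, and use rep E_ii <= 1: this
    is the Schwarz inequality for the matrix unit E_ij. *)
Lemma rep_delta_schwarz i j y : adjeq G i j ->
  inner (E i j y) (E i j y) <= inner (E j j y) y.
Proof.
move=> ij; set X := E i j y.
have le1 : inner (E i i X) X <= inner X X.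
  have e : X = (\sum_k E k k) X.
    have s k : supported G (delta_mx k k : 'M[C]_d) := supported_delta (adjeq_refl G k).
    by rewrite -(linear_on_sum rep_lin)// -mx1_sum_delta rep1.
  rewrite {3}e fct_sumE inner_suml (bigD1 i)//= lerDl.
  by rewrite sumr_ge0// => k _; exact: rep_delta_ge0.
have ji : adjeq G j i by rewrite adjeq_sym.
have := rep_delta_block ij (- X) y; rewrite -/X.
have l1 : linear (E i i) by apply: rep_linear; apply: supported_delta; exact: adjeq_refl.
rewrite (rep_delta_adj _ _ ij) -/X (linear_funN l1) !innerNl !innerNr opprK.
move=> h; rewrite -subr_ge0; apply: (le_trans h).
rewrite -subr_ge0; have := le1; rewrite -subr_ge0; congr (0 <= _); ring.
Qed.

Lemma rep_delta_contract i j y : adjeq G i j -> `|E i j y| <= `|y|.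
Proof.
move=> ij; rewrite -ler_sqr ?nnegrE// -!inner_norm.
apply: (le_trans (rep_delta_schwarz y ij)).
have e : y = (\sum_k E k k) y.
  have s k : supported G (delta_mx k k : 'M[C]_d) := supported_delta (adjeq_refl G k).
  by rewrite -(linear_on_sum rep_lin)// -mx1_sum_delta rep1.
rewrite {3}e fct_sumE inner_suml (bigD1 j)//= lerDl.
by rewrite sumr_ge0// => k _; exact: rep_delta_ge0.
Qed.

Lemma rep_norm_le A y : supported G A ->
  `|rep A y| <= (\sum_i \sum_j `|A i j|) * `|y|.
Proof.
move=> hA; rewrite (linear_on_delta rep_lin hA) fct_sumE mulr_suml.
apply: (le_trans (ler_norm_sum _ _ _)); apply: ler_sum => i _.
rewrite fct_sumE mulr_suml.
apply: (le_trans (ler_norm_sum _ _ _)); apply: ler_sum => j _.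
rewrite normrZ; have [->|/hA Aij] := eqVneq (A i j) 0; first by rewrite normr0 !mul0r.
by rewrite ler_wpM2l// rep_delta_contract.
Qed.

End Embedding.

(** * The range of an embedding is norm closed *)

Section EmbeddingClosed.
Variables (R : realType) (d : nat) (G : sgraph d) (L : hilbertType R).
Local Notation C := R[i].
Local Open Scope sesquilinear_scope.
Variable phi : (euclid R d -> euclid R d) -> (L -> L).
Hypothesis uco : unital_complete_order_embedding (graph_opsys R G) phi.
Local Notation rep := (rep phi).
Local Notation rep_lin := (rep_lin uco).

Lemma rep_scalar a x : rep a%:M x = a *: x.
Proof.
by rewrite -scalemx1 (linear_onZ rep_lin) ?(rep1 uco)//; exact: supported_scalar.
Qed.

(** When rep A has norm at most e, [[e, rep A], [rep A^*, e]] is positive, hence so is [[e, A],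
    [A^*, e]]; two multiples of basis vectors then read off the entry. *)
Lemma rep_entry_le A (e : C) : supported G A -> 0 <= e ->
  opnorm_le (rep A) e -> forall i j, `|A i j| <= e.
Proof.
move=> hA e0 hop i j.
have [->|Aij] := eqVneq (A i j) 0; first by rewrite normr0.
have : psd_block (e%:M) A (A^t*) (e%:M).
  apply/(psd_block_rep uco); rewrite ?rep_scalar//; try exact: supported_scalar.
    exact: supported_adj.
  move=> x y; rewrite !rep_scalar !innerZl !inner_norm (rep_adjr uco)// (innerC x).
  set z := inner _ _.
  have zle : `|z| <= e * `|x| * `|y|.
    apply: (le_trans (inner_cauchy_schwarz _ _)).
    by rewrite mulrAC ler_wpM2r.
  have zr : z + z^* \is Num.real.
    by apply/CrealP; rewrite rmorphD /= conjCK addrC.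
  have h1 : - (z + z^*) <= `|z| *+ 2.
    apply: (le_trans (real_ler_norm _)); first by rewrite rpredN.
    by rewrite normrN (le_trans (ler_normD _ _))// norm_conjC mulr2n.
  have h2 : - (z + z^*) <= (e * `|x| * `|y|) *+ 2 by rewrite (le_trans h1)// lerMn2r.
  rewrite -addrA -addrA [z + _]addrA addrCA -[z + _]opprK addrC subr_ge0.
  apply: (le_trans h2); rewrite -subr_ge0.
  (* By Cauchy-Schwarz the block form is bounded below by this completed square. *)
  have -> : e * `|x| ^+ 2 + e * `|y| ^+ 2 - e * `|x| * `|y| *+ 2 =
     e * (`|x| - `|y|) ^+ 2 by rewrite mulr2n; ring.
  rewrite mulr_ge0//; apply: real_exprn_even_ge0 => //.
  by rewrite rpredB ?normr_real.
(* The phase of the entry, which turns each cross term into - |A_ij|. *)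
pose s := A i j / `|A i j|.
have n0 : `|A i j| != 0 by rewrite normr_eq0.
have ns : s * s^* = 1 by rewrite -normCK normrM normfV normr_id divff// expr1n.
have sA : s^* * A i j = `|A i j|.
  rewrite rmorphM /= fmorphV /= (CrealP (normr_real _)).
  by rewrite mulrAC [_ * A i j]mulrC -normCK expr2 mulfK.
move=> /(_ (- (s *: delta_mx i ord0)) (delta_mx j ord0)).
rewrite !mulmxN -!scalemxAr !mul_scalar_mx.
have cN (u v : 'cV[C]_d) : cdot (- u) v = - cdot u v by rewrite -scaleN1r cdotZl mulN1r.
have cNr (u v : 'cV[C]_d) : cdot u (- v) = - cdot u v by rewrite cdotC cN rmorphN /= -cdotC.
have cd (k : 'I_d) : cdot (delta_mx k ord0 : 'cV[C]_d) (delta_mx k ord0) = 1.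
  by have := cdot_delta (1%:M : 'M[C]_d) k k; rewrite mul1mx => ->; rewrite mxE eqxx.
rewrite !(cN, cNr, cdotZl, cdotZr) !cd !cdot_delta !mxE sA opprK.
have -> : s * (A i j)^* = `|A i j|.
  by rewrite -[LHS]conjCK rmorphM /= conjCK sA (CrealP (normr_real _)).
have -> : s^* * (s * (e * 1)) = e by rewrite mulrCA mulrA ns mul1r mulr1.
rewrite mulr1 => h; have : 0 <= (e - `|A i j|) *+ 2.
  by move: h; congr (0 <= _); rewrite mulr2n; ring.
by rewrite -mulr_natr pmulr_lge0 ?ltr0n// subr_ge0.
Qed.

(* The coefficient matrices of operators close to T generate a Cauchy filter by
   rep_entry_le. *)
Lemma rep_closed T : opclosure (phi @` graph_opsys R G) T ->
  exists2 A, supported G A & T = rep A.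
Proof.
move=> [Tb hT].
have [Tl Tc] := Tb.
(* Matrices are flattened to vectors in order to use the completeness of C^(d * d). *)
pose mat (x : euclid R (d * d)) : 'M[C]_d := vec_mx x^T.
have matE x i j : mat x i j = x (mxvec_index i j) ord0 by rewrite !mxE.
pose B (e : C) : set (euclid R (d * d)) :=
  [set x | supported G (mat x) /\ opnorm_le (T - rep (mat x)) e].
have B0 e : 0 < e -> exists x, B e x.
  move=> /hT[S [_ /graph_opsysP[A hA ->] <-] hS].
  by exists (mxvec A)^T; rewrite /B /= /mat trmxK mxvecK.
pose F := filter_from [set e : C | 0 < e] B.
have FF : ProperFilter F.
  apply: filter_from_proper; last by move=> e /B0[x Bx]; exists x.
  apply: filter_from_filter; first by exists 1 => /=.
  have mono e e' : e <= e' -> B e `<=` B e'.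
    by move=> ee' x [sx hx]; split=> // v; rewrite (le_trans (hx v))// ler_wpM2r.
  move=> e e' /= e0 e'0.
  have /orP[ee'|e'e] := real_leVge (gtr0_real e0) (gtr0_real e'0).
    by exists e => // x Bx; split => //; exact: mono Bx.
  by exists e' => // x Bx; split => //; exact: mono Bx.
have dist e x y : 0 <= e -> B e x -> B e y ->
    forall i j, `|mat x i j - mat y i j| <= e *+ 2.
  move=> e0 [sx hx] [sy hy] i j.
  have -> : mat x i j - mat y i j = (mat x - mat y) i j by rewrite !mxE.
  apply: rep_entry_le.
  - by rewrite -scaleN1r; apply: supportedD => //; exact: supportedZ.
  - by rewrite mulrn_wge0.
  - move=> v; rewrite -scaleN1r addrC rep_lin// scaleN1r.
    have -> : (- rep (mat y) + rep (mat x)) v =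
       (T - rep (mat y)) v - (T - rep (mat x)) v.
      by rewrite !fctE opprB [RHS]addrC [RHS]addrA subrK addrC.
    apply: (le_trans (ler_normB _ _)).
    by rewrite mulr2n mulrDl; apply: lerD; [exact: hy|exact: hx].
have Fc : cauchy F.
  apply: cauchy_exP => e e0.
  (* Entries of two members of [B a] differ by at most 2 a, so the vectors differ by at most d^2 * 2
     a < e; the successor keeps the denominator nonzero when d = 0. *)
  pose a := e / (4 * (d * d).+1%:R).
  have a0 : 0 < a by rewrite divr_gt0// mulr_gt0// ltr0n.
  have [x Bx] := B0 _ a0; exists x, a => //= y By.
  rewrite -ball_normE /=.
  have h : `|x - y| <= (d * d)%:R * (a *+ 2).
    apply: euclid_norm_le; first by rewrite mulrn_wge0// ltW.
    move=> k; case/mxvec_indexP: k => i j; rewrite !mxE.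
    by have := dist _ _ _ (ltW a0) Bx By i j; rewrite !matE.
  apply: (le_lt_trans h); rewrite -[a *+ 2]mulr_natl /a !mulrA.
  rewrite ltr_pdivrMr ?mulr_gt0 ?ltr0n// mulrC ltr_pM2l//.
  by rewrite -!natrM ltr_nat mulnC ltn_mul.
have /cvg_ex[l Fl] := @cauchy_cvg _ F FF Fc.
have near_l e : 0 < e -> exists2 y, B e y & `|l - y| <= e.
  move=> e0; have h1 : F (B e) by exists e.
  have h2 : F (ball l e) := Fl _ (nbhsx_ballx l e e0).
  have [y [h3]] := filter_ex (filterI h1 h2).
  by rewrite -ball_normE => /ltW; exists y.
have matl e y : `|l - y| <= e -> forall i j, `|mat l i j - mat y i j| <= e.
  move=> ly i j; rewrite !matE; apply: le_trans ly.
  by have := euclid_coord_le (l - y) (mxvec_index i j); rewrite !mxE.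
have sl : supported G (mat l).
  move=> i j lij; apply/negPn/negP => nij.
  (* A supported matrix within half of this entry would itself have a nonzero entry at the non-edge
     (i, j). *)
  have e0 : 0 < `|mat l i j| / 2 by rewrite divr_gt0 ?normr_gt0.
  have [y [sy _] ly] := near_l _ e0.
  have y0 : mat y i j = 0 by apply/eqP/negPn/negP => /sy; rewrite (negPf nij).
  have := matl _ _ ly i j; rewrite y0 subr0 ler_pdivlMr//.
  by rewrite mulr2n mulrDr mulr1 gerDl normr_le0 (negPf lij).
exists (mat l) => //; apply/funext => x.
have bnd e : 0 < e -> `|T x - rep (mat l) x| <= (1 + (d * d)%:R) * `|x| * e.
  move=> e0; have [y [sy hy] ly] := near_l _ e0.
  have -> : T x - rep (mat l) x = (T - rep (mat y)) x - rep (mat l - mat y) x.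
    rewrite [X in _ = _ - rep X x](_ : _ = (- 1) *: mat y + mat l); last first.
      by rewrite scaleN1r addrC.
    by rewrite rep_lin// !fctE scaleN1r opprD opprK addrA subrK.
  apply: (le_trans (ler_normB _ _)).
  rewrite -mulrA mulrDl mul1r; apply: lerD; first by rewrite mulrC; exact: hy.
  have sB : supported G (mat l - mat y).
    by rewrite -scaleN1r; apply: supportedD => //; exact: supportedZ.
  apply: (le_trans (rep_norm_le uco x sB)).
  rewrite [leRHS]mulrA mulrAC ler_wpM2r//.
  apply: (@le_trans _ _ (\sum_(i < d) \sum_(j < d) e)).
    apply: ler_sum => i _; apply: ler_sum => j _.
    by have := matl _ _ ly i j; rewrite !mxE.
  by rewrite !sumr_const !card_ord -mulrnA mulr_natl.
apply/eqP; rewrite -subr_eq0 -normr_eq0; apply/negPn/negP => n0.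
set c := (1 + (d * d)%:R) * `|x| in bnd.
have c0 : 0 < c + 1 by rewrite ltr_wpDl// mulr_ge0// addr_ge0.
set t := `|T x - _| in bnd n0.
have t0 : 0 < t by rewrite lt_def n0 normr_ge0.
have := bnd (t / (c + 1)); rewrite divr_gt0// => /(_ isT).
rewrite mulrCA ler_pMr// ler_pdivlMr// mul1r gerDl.
by rewrite ler10.
Qed.
End EmbeddingClosed.

(** * Multiplicativity of the inverse of an embedding *)

Section EmbeddingModule.
Variables (R : realType) (d : nat) (G : sgraph d) (L : hilbertType R).
Local Notation C := R[i].
Local Open Scope sesquilinear_scope.
Variable phi : (euclid R d -> euclid R d) -> (L -> L).
Hypothesis uco : unital_complete_order_embedding (graph_opsys R G) phi.
Local Notation rep := (rep phi).
Local Notation rep_lin := (rep_lin uco).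

(* With X = rep E_ij the matrix [[1, X, a'], [X^*, rep E_jj, (a X)^*], [a, a X, a a']]
   is positive because X^* X <= rep E_jj. In the corresponding matrix over
   S_G, the Schur complement of the first row has a zero diagonal entry, since
   E_ij^* E_ij = E_jj, so its off-diagonal entry t0 - a0 E_ij vanishes. *)
Lemma rep_mul_delta (a a' : L -> L) a0 c0 t0 i j :
  adjoint_pair a a' -> adjeq G i j ->
  supported G a0 -> supported G c0 -> supported G t0 ->
  a = rep a0 -> a \o a' = rep c0 -> a \o rep (delta_mx i j) = rep t0 ->
  t0 = a0 *m delta_mx i j.
Proof.
move=> [la la' haa'] ij sa sc st ea ec et.
set E : 'M[C]_d := delta_mx i j; set X := rep E.
have sE : supported G E by exact: supported_delta.
have sjj : supported G (delta_mx j j : 'M[C]_d) := supported_delta (adjeq_refl G j).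
pose M (s t : 'I_3) : 'M[C]_d :=
  nth 0 (nth [::] [:: [:: 1%:M; E; a0^t*]; [:: E^t*; delta_mx j j; t0^t*];
                      [:: a0; t0; c0]] s) t.
have sM s t : supported G (M s t).
  by case: s => -[|[|[|//]]] hs; case: t => -[|[|[|//]]] ht; rewrite /M /=;
    try exact: supported_scalar; try exact: supported_adj.
have hM xi : 0 <= \sum_s \sum_t inner (rep (M s t) (xi t)) (xi s).
  rewrite !big_ord_recl !big_ord0 /M /= !addr0 (rep1 uco).
  set x := xi _; set y := xi _; set z := xi _.
  rewrite !(rep_adjr uco)// -/X -ea -et -ec /=.
  (* The form is |x + X y + a' z|^2 plus the defect <rep E_jj y, y> - |X y|^2. *)
  have := inner_ge0 (x + X y + a' z); have := rep_delta_schwarz uco y ij.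
  rewrite -/X -subr_ge0 => h1 h2; have := addr_ge0 h1 h2.
  rewrite !innerDl !innerDr !haa'; congr (0 <= _).
  rewrite (innerC z (a _)) haa' -innerC.
  rewrite (innerC z (a _)) haa' -innerC.
  by ring.
have {}hM := (rep_pos uco sM).2 hM.
suff e v w : cdot ((t0 - a0 *m E) *m v) w = 0.
  apply/eqP; rewrite -subr_eq0; apply/eqP/matrixP => k l.
  by rewrite -cdot_delta e mxE.
pose q := a0^t* *m w.
have [] // := @affine_ge0_eq0 C (cdot (c0 *m w) w - cdot q q)
   (cdot ((t0 - a0 *m E) *m v) w) (cdot w ((t0 - a0 *m E) *m v)) _ => s.
pose p := E *m (s *: v).
(* The first coordinate completes the square in the first row. The term quadratic in s cancels
   because E_jj = E^* E, which leaves a form affine in s. *)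
have := hM (fun k => nth 0 [:: - (p + q); s *: v; w] k).
rewrite !big_ord_recl !big_ord0 /M /= !addr0 mul1mx.
rewrite -/p -/q.
have EE : delta_mx j j = E^t* *m E.
  by rewrite /E trmx_delta map_delta_mx mul_delta_mx.
have Dsv : (t0 - a0 *m E) *m (s *: v) = t0 *m (s *: v) - a0 *m p.
  by rewrite mulmxBl -mulmxA.
rewrite EE -mulmxA -cdotZl -cdotZr scalemxAr Dsv -/p.
have hq x : cdot (a0 *m x) w = cdot x q by rewrite cdot_adj.
have hq' x : cdot w (a0 *m x) = cdot q x by rewrite cdotC hq -cdotC.
have hp x : cdot (E^t* *m x) (s *: v) = cdot x p by rewrite cdot_adj trmxCK.
have ht : cdot (t0^t* *m w) (s *: v) = cdot w (t0 *m (s *: v)) by rewrite cdot_adj trmxCK.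
rewrite !cdotBl !cdotBr ht !hq hq' !hp; clearbody p q.
have cN (x y : 'cV[C]_d) : cdot (- x) y = - cdot x y by rewrite -scaleN1r cdotZl mulN1r.
have cNr (x y : 'cV[C]_d) : cdot x (- y) = - cdot x y by rewrite cdotC cN rmorphN /= -cdotC.
rewrite !cN !cNr !cdotDl !cdotDr.
by congr (0 <= _); ring.
Qed.

(* Equal to 0 outside the range of rep. *)
Definition rep_inv (T : L -> L) : 'M[C]_d :=
  xget 0 [set A | supported G A /\ rep A = T].

Definition rep_range (T : L -> L) := exists2 A, supported G A & T = rep A.

Lemma repK A : supported G A -> rep_inv (rep A) = A.
Proof.
move=> hA; rewrite /rep_inv; apply: xget_unique; first by split.
by move=> B [hB] /(rep_inj uco hB hA).
Qed.

Lemma rep_range_rep A : supported G A -> rep_range (rep A).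
Proof. by exists A. Qed.

Lemma rep_invK T : rep_range T -> rep (rep_inv T) = T.
Proof. by move=> [A hA ->]; rewrite repK. Qed.

Lemma rep_inv_supported T : rep_range T -> supported G (rep_inv T).
Proof. by move=> [A hA ->]; rewrite repK. Qed.

Lemma rep_range_lin a T U : rep_range T -> rep_range U -> rep_range (a *: T + U).
Proof.
move=> [A hA ->] [B hB ->]; exists (a *: A + B); first exact: supported_lin.
by rewrite rep_lin.
Qed.

Lemma rep_inv_lin a T U : rep_range T -> rep_range U ->
  rep_inv (a *: T + U) = a *: rep_inv T + rep_inv U.
Proof.
by move=> [A hA ->] [B hB ->]; rewrite -rep_lin// !repK//; exact: supported_lin.
Qed.

Lemma rep_range0 : rep_range 0.
Proof.
by exists 0; [exact: supported0|rewrite (linear_on0 rep_lin)].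
Qed.

(** Range membership is asked only where the coefficient is nonzero, so that expansions over all
    pairs of vertices are allowed. *)
Lemma rep_inv_sum (I : Type) (r : seq I) (P : pred I) (c : I -> C) (T : I -> L -> L) :
  (forall i, P i -> c i != 0 -> rep_range (T i)) ->
  rep_range (\sum_(i <- r | P i) c i *: T i) /\
  rep_inv (\sum_(i <- r | P i) c i *: T i) =
    \sum_(i <- r | P i) c i *: rep_inv (T i).
Proof.
move=> h; elim/big_rec2: _ => [|i y1 y2 Pi [r1 e1]].
  by split; [exact: rep_range0|rewrite -(linear_on0 rep_lin) repK//; exact: supported0].
have [->|ci] := eqVneq (c i) 0; first by rewrite !scale0r !add0r.
have ri := h i Pi ci; split; first exact: rep_range_lin.
by rewrite rep_inv_lin// e1.
Qed.

Lemma rep_inv_adj T T' : rep_range T ->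
  (forall x y, inner (T x) y = inner x (T' y)) ->
  rep_range T' /\ rep_inv T' = (rep_inv T)^t*.
Proof.
move=> [A hA ->] h.
have e : T' = rep (A^t*).
  apply/funext => y; apply: inner_ext => x.
  by rewrite innerC -h (rep_adj uco)// -innerC.
have sA := supported_adj hA.
by rewrite e !repK//; split=> //; exists (A^t*).
Qed.

(** By linearity this reduces to matrix units, the case of [rep_mul_delta]. *)
Lemma rep_inv_mul (a a' : L -> L) (s : L -> L) :
  adjoint_pair a a' -> rep_range a -> rep_range (a \o a') ->
  (forall A, supported G A -> rep_range (a \o rep A)) ->
  rep_range s -> rep_inv (a \o s) = rep_inv a *m rep_inv s.
Proof.
move=> haa ra raa ras [A hA ->]; rewrite (repK hA).
have la : linear a by case: haa.
have aE : a \o rep A = \sum_p A p.1 p.2 *: (a \o rep (delta_mx p.1 p.2)).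
  apply/funext => x; rewrite /= {1}(linear_on_delta rep_lin hA) pair_big /= !fct_sumE.
  rewrite (linear_fun_sum la); apply: eq_bigr => p _.
  by rewrite fctE (linear_funZ la).
rewrite aE; have [_ ->] := @rep_inv_sum _ (index_enum _) xpredT (fun p : 'I_d * 'I_d => A p.1 p.2)
  (fun p => a \o rep (delta_mx p.1 p.2)) (fun p _ Ap => ras _ (supported_delta (hA _ _ Ap))).
rewrite {2}[A]matrix_sum_delta pair_big /= mulmx_sumr; apply: eq_bigr => -[i j] _ /=.
have [->|Aij] := eqVneq (A i j) 0; first by rewrite !scale0r mulmx0.
rewrite -scalemxAr; congr (_ *: _); have ij := hA _ _ Aij.
have rt := ras _ (supported_delta ij).
by apply: (rep_mul_delta (c0 := rep_inv (a \o a')) haa ij); rewrite ?rep_invK//;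
  exact: rep_inv_supported.
Qed.

End EmbeddingModule.

(** * Two-sided multipliers and twin vertices *)

Section TwoSidedModule.
Variables (R : realType) (d : nat) (G : sgraph d) (L : hilbertType R).
Local Notation C := R[i].
Local Open Scope sesquilinear_scope.
Variable phi : (euclid R d -> euclid R d) -> (L -> L).
Hypothesis uco : unital_complete_order_embedding (graph_opsys R G) phi.
Local Notation rep := (rep phi).
Local Notation rep_inv := (rep_inv G phi).
Local Notation rep_range := (rep_range G phi).

(* Adjoints are carried along explicitly, since not every bounded operator is
   known to have one without the Riesz representation theorem. *)
Definition left_multiplier (a a' : L -> L) :=
  [/\ adjoint_pair a a', rep_range a, rep_range (a \o a')
    & forall A, supported G A -> rep_range (a \o rep A)].

(** Left multiplicativity of b' on A^* becomes, after taking adjoints, right multiplicativity of b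
    on A; then a acts on the left. *)
Lemma rep_inv_mul2 a a' b b' A : left_multiplier a a' -> left_multiplier b' b ->
  supported G A ->
  rep_range (a \o rep A \o b) /\
  rep_inv (a \o rep A \o b) = rep_inv a *m A *m rep_inv b.
Proof.
move=> [haa ra raa ha] [hbb rb rbb hb] sA; have sA' := supported_adj sA.
have e1 := rep_inv_mul uco hbb rb rbb hb (rep_range_rep phi sA').
have r1 := hb _ sA'.
have adj1 x y : inner ((b' \o rep (A^t*)) x) y = inner x ((rep A \o b) y).
  by have [_ _ h] := hbb; rewrite /= h (rep_adjr uco).
have [r2 e2] := rep_inv_adj uco r1 adj1.
have [_ e3] : rep_range b /\ rep_inv b = (rep_inv b')^t*.
  by apply: rep_inv_adj => //; have [] := hbb.
have r3 : rep_range (a \o (rep A \o b)).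
  by rewrite -(rep_invK uco r2); apply: ha; exact: rep_inv_supported uco _ r2.
split; first exact: r3.
have -> : a \o rep A \o b = a \o (rep A \o b) by [].
rewrite (rep_inv_mul uco haa ra raa ha r2) e2 e1 (repK uco)//.
by rewrite adjmxM trmxCK -e3 mulmxA.
Qed.

Definition twin (u v : 'I_d) := forall w, adjeq G u w = adjeq G v w.

(** For t adjacent or equal to w, theta(a) E_tw is again supported on G, and its (s, w) entry is
    theta(a)_st. If this is nonzero, the closed neighbourhood of t lies in that of s; the adjoint
    gives the other inclusion. *)
Lemma left_multiplier_twin a a' u v : left_multiplier a a' -> left_multiplier a' a ->
  rep_inv a u v != 0 -> twin u v.
Proof.
have half b b' s t : left_multiplier b b' -> rep_inv b s t != 0 ->
    forall w, adjeq G t w -> adjeq G s w.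
  move=> [hbb rb rbb hb] st w tw.
  have sd : supported G (delta_mx t w : 'M[C]_d) := supported_delta tw; have := rep_inv_supported uco (hb _ sd).
  rewrite (rep_inv_mul uco hbb rb rbb hb (rep_range_rep phi sd)) (repK uco)//.
  apply; rewrite mxE (bigD1 t)//= big1 => [|k kt].
    by rewrite mxE !eqxx mulr1 addr0.
  by rewrite mxE (negPf kt) mulr0.
move=> h h' uv w; apply/idP/idP; last exact: (half _ _ _ _ h uv).
apply: (half _ _ _ _ h').
have [[_ _ haa] ra _ _] := h.
have [_ ->] := rep_inv_adj uco ra haa.
by rewrite !mxE conjC_eq0.
Qed.

End TwoSidedModule.

(** * Positivity of compressions between the two spaces *)

Section Compression.
Variables (R : realType) (d d' : nat) (G : sgraph d) (H : sgraph d').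
Variables (L K : hilbertType R).
Local Notation C := R[i].
Local Open Scope sesquilinear_scope.
Variable phi : (euclid R d -> euclid R d) -> (L -> L).
Variable psi : (euclid R d' -> euclid R d') -> (K -> K).
Hypothesis ucoG : unital_complete_order_embedding (graph_opsys R G) phi.
Hypothesis ucoH : unital_complete_order_embedding (graph_opsys R H) psi.

(** On L the form equals that of rep psi B at the vectors eta_a, the sum of q_i xi_i over the i with
    s i = a. The map [s] lets several indices share a block. *)
Lemma compress_pos (I S : finType) (s : I -> S) (B : S -> S -> 'M[C]_d')
    (q : I -> L -> K) (q' : I -> K -> L) :
  (forall a b, supported H (B a b)) ->
  (forall xi : S -> 'cV[C]_d', 0 <= \sum_a \sum_b cdot (B a b *m xi b) (xi a)) ->
  (forall i, adjoint_pair (q i) (q' i)) ->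
  (forall i j, rep_range G phi (q' i \o rep psi (B (s i) (s j)) \o q j)) ->
  forall xi : I -> 'cV[C]_d, 0 <= \sum_i \sum_j
    cdot (rep_inv G phi (q' i \o rep psi (B (s i) (s j)) \o q j) *m xi j) (xi i).
Proof.
move=> sB pB qq rB.
apply/(rep_pos ucoG) => [i j|xi]; first exact: rep_inv_supported.
under eq_bigr => i _.
  under eq_bigr => j _.
    rewrite (rep_invK ucoG (rB i j)) /=.
    have [_ _ h] := adjoint_pair_sym (qq i); rewrite h.
    over.
  over.
pose eta a := \sum_(i | s i == a) q i (xi i).
have := (rep_pos ucoH sB).1 pB eta; congr (0 <= _).
rewrite [RHS](partition_big s xpredT)//=; apply: eq_bigr => a _.
rewrite [RHS]exchange_big [RHS](partition_big s xpredT)//=; apply: eq_bigr => b _.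
rewrite {1}/eta (linear_fun_sum (rep_linear ucoH (sB a b))) inner_suml.
apply: eq_bigr => j /eqP <-; rewrite inner_sumr.
by apply: eq_bigr => i /eqP <-.
Qed.

End Compression.

(** * Congruence and Hermitian minors *)

Section Congruence.
Variable R : realType.
Local Notation C := R[i].
Local Open Scope sesquilinear_scope.

Lemma psd_congr m n (A : 'M[C]_m) (D : 'M[C]_(n, m)) : psd A -> psd (D *m A *m D^t*).
Proof. by move=> pA v; rewrite -!mulmxA cdot_adj. Qed.

Lemma psd_congr_unit n (A Z : 'M[C]_n) : Z \in unitmx -> Z^t* = Z ->
  psd (Z *m A *m Z) -> psd A.
Proof.
move=> Zu ZZ h v; have := h (invmx Z *m v).
by rewrite -!mulmxA cdot_adj ZZ mulKVmx.
Qed.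

Lemma posdef_unit n (A : 'M[C]_n) e : 0 < e -> psd (A - e%:M) ->
  A \in unitmx /\ A^t* = A.
Proof.
move=> e0 h.
have hv v : e * cdot v v <= cdot (A *m v) v.
  by have := h v; rewrite mulmxBl cdotBl mul_scalar_mx cdotZl subr_ge0.
have pA : psd A.
  by move=> v; apply: le_trans (hv v); rewrite mulr_ge0 ?cdot_ge0// ltW.
split; last exact: psd_adj.
rewrite -unitmx_tr -row_free_unit; apply: inj_row_free => u uA.
have Au : A *m u^T = 0 by rewrite -[A]trmxK -trmx_mul uA trmx0.
apply: trmx_inj; rewrite trmx0; apply/eqP; rewrite -cdot_eq0 eq_le cdot_ge0 andbT.
by have := hv u^T; rewrite Au cdot0l pmulr_rle0.
Qed.

Lemma hermitian_rowsub m n (A : 'M[C]_n) (f : 'I_m -> 'I_n) :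
  A^t* = A -> (rowsub f A)^t* = colsub f A.
Proof.
by move=> AA; apply/matrixP => i j; rewrite !mxE -[in RHS]AA !mxE.
Qed.

Lemma hermitian_mxsub m n (A : 'M[C]_n) (f : 'I_m -> 'I_n) :
  A^t* = A -> (mxsub f f A)^t* = mxsub f f A.
Proof.
by move=> AA; apply/matrixP => i j; rewrite !mxE -[in RHS]AA !mxE.
Qed.

End Congruence.

(** * Order embeddings in both directions yield a graph isomorphism *)

Definition order_embedding (R : realType) d N (G : sgraph d) (G' : sgraph N)
    (Psi : 'M[R[i]]_d -> 'M[R[i]]_N) :=
  [/\ linear_on G Psi,
      forall A, supported G A -> psd (Psi A) -> psd A,
      forall k l, adjeq G k l ->
        psd_block (Psi (delta_mx k k)) (Psi (delta_mx k l))
                  (Psi (delta_mx l k)) (Psi (delta_mx l l))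
    & forall A, supported G A -> supported G' (Psi A)].

(** The vertex counts agree by [order_embedding_leq] both ways. Each embedding gives a permutation
    injecting one set of adjacent-or-equal pairs into the other; by counting, the first injection is
    onto, so it also reflects adjacency. *)
Lemma order_embedding_iso (R : realType) d N (G : sgraph d) (G' : sgraph N)
    (Psi : 'M[R[i]]_d -> 'M[R[i]]_N) (Phi : 'M[R[i]]_N -> 'M[R[i]]_d) :
  order_embedding G G' Psi -> order_embedding G' G Phi ->
  exists s : 'I_d -> 'I_N, bijective s /\
    forall k l, adjeq G k l = adjeq G' (s k) (s l).
Proof.
move=> [l1 r1 b1 s1] [l2 r2 b2 s2].
have dN : d = N.
  apply/eqP; rewrite eqn_leq (order_embedding_leq l1 r1 b1).
  exact: order_embedding_leq l2 r2 b2.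
case: N / dN G' Psi Phi l1 r1 b1 s1 l2 r2 b2 s2 => G' Psi Phi l1 r1 b1 s1 l2 r2 b2 s2.
have [s hs] := order_embedding_perm l1 r1 b1 s1.
have [t ht] := order_embedding_perm l2 r2 b2 s2.
exists s; split; first by exists (s^-1)%g => i; rewrite ?permK ?permKV.
pose E (F : sgraph d) : {set 'I_d * 'I_d} := finset (fun e => adjeq F e.1 e.2).
pose m (u : {perm 'I_d}) (e : 'I_d * 'I_d) := (u e.1, u e.2).
have mi u : injective (m u) by move=> [a b] [a' b'] [/perm_inj -> /perm_inj ->].
have h1 : m s @: E G \subset E G'.
  by apply/fintype.subsetP => _ /imsetP[e eG ->]; move: eG; rewrite !inE; exact: hs.
have h2 : m t @: E G' \subset E G.
  by apply/fintype.subsetP => _ /imsetP[e eG ->]; move: eG; rewrite !inE; exact: ht.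
have /eqP h : m s @: E G == E G'.
  rewrite eqEcard h1 card_imset//.
  by have := subset_leq_card h2; rewrite card_imset.
move=> k l; have : ((k, l) \in E G) = (m s (k, l) \in m s @: E G).
  by rewrite mem_imset.
by rewrite h !inE.
Qed.

(** * Pulling a graph back along a map of vertices *)

Section PullGraph.
Variables (d : nat) (G : sgraph d).

Definition pull_graph N (x : 'I_N -> 'I_d) : sgraph N.
Proof.
apply: (@SGraph N [rel i j | (i != j) && adjeq G (x i) (x j)]).
  by move=> i j; rewrite /= eq_sym adjeq_sym.
by move=> i; rewrite /= eqxx.
Defined.

Lemma adjeq_pull_graph N (x : 'I_N -> 'I_d) i j :
  adjeq (pull_graph x) i j = adjeq G (x i) (x j).
Proof.
rewrite {1}/adjeq /=; have [->|_] := eqVneq i j; last by rewrite orbF.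
by rewrite adjeq_refl.
Qed.

End PullGraph.

Lemma sum_pair_pair (V : nmodType) (S I : finType) (F : S -> I -> S -> I -> V) :
  \sum_(i : S * I) \sum_(j : S * I) F i.1 i.2 j.1 j.2 =
  \sum_a \sum_b \sum_i \sum_j F a i b j.
Proof.
rewrite -(pair_bigA _ (fun a i => \sum_(j : S * I) F a i j.1 j.2)) /=.
apply: eq_bigr => a _; rewrite [RHS]exchange_big /=; apply: eq_bigr => i _.
by rewrite (pair_bigA _ (fun b j => F a i b j)).
Qed.

Lemma cdot_mul_sum (R : realType) m n (A : 'M[R[i]]_(m, n)) u v :
  cdot (A *m v) u = \sum_i \sum_j A i j * (v j ord0 * (u i ord0)^*).
Proof.
rewrite /cdot; apply: eq_bigr => i _; rewrite mxE mulr_suml.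
by apply: eq_bigr => j _; rewrite mulrA.
Qed.

(** * Transfer between graph operator systems along a TRO *)

Section Transfer.
Variables (R : realType) (d d' : nat) (G : sgraph d) (H : sgraph d').
Variables (L K : hilbertType R).
Local Notation C := R[i].
Local Open Scope sesquilinear_scope.
Variable phi : (euclid R d -> euclid R d) -> (L -> L).
Variable psi : (euclid R d' -> euclid R d') -> (K -> K).
Hypothesis ucoG : unital_complete_order_embedding (graph_opsys R G) phi.
Hypothesis ucoH : unital_complete_order_embedding (graph_opsys R H) psi.
Variables (n : nat) (p : 'I_n -> L -> K) (p' : 'I_n -> K -> L).
Hypothesis pp : forall i, adjoint_pair (p i) (p' i).
Hypothesis rangeG : forall i j B, supported H B ->
  rep_range G phi (p' i \o rep psi B \o p j).
Hypothesis rangeH : forall i j A, supported G A ->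
  rep_range H psi (p i \o rep phi A \o p' j).
Hypothesis multG : forall i j,
  left_multiplier G phi (p' i \o p j) (p' j \o p i).
Hypothesis multH : forall i j,
  left_multiplier H psi (p i \o p' j) (p j \o p' i).

Local Notation thG := (rep_inv G phi).
Local Notation thH := (rep_inv H psi).

Let pl i : linear (p i). Proof. by case: (pp i). Qed.
Let pl' i : linear (p' i). Proof. by case: (pp i). Qed.

(** The compression of psi(B) to the vectors v_i = p_(k i) (x) e_(x i); at B = 1 it is their Gram
    matrix. *)
Definition down N (k : 'I_N -> 'I_n) (x : 'I_N -> 'I_d) (B : 'M[C]_d') : 'M[C]_N :=
  \matrix_(i, j) thG (p' (k i) \o rep psi B \o p (k j)) (x i) (x j).

(** The operator sum_ij A_ij v_i v_j^* built from the same vectors, read through the inverse of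
    psi. *)
Definition up N (k : 'I_N -> 'I_n) (x : 'I_N -> 'I_d) (A : 'M[C]_N) : 'M[C]_d' :=
  \sum_i \sum_j A i j *:
    thH (p (k i) \o rep phi (delta_mx (x i) (x j)) \o p' (k j)).

Lemma thG_lin i j : linear_on H (fun B => thG (p' i \o rep psi B \o p j)).
Proof.
move=> a A B sA sB.
rewrite -(rep_inv_lin ucoG); [|exact: rangeG|exact: rangeG].
congr (thG _); apply/funext => v; rewrite /= (rep_lin ucoH)// !fctE /=.
by rewrite pl'.
Qed.

Lemma thH_lin i j : linear_on G (fun A => thH (p i \o rep phi A \o p' j)).
Proof.
move=> a A B sA sB.
rewrite -(rep_inv_lin ucoH); [|exact: rangeH|exact: rangeH].
congr (thH _); apply/funext => v; rewrite /= (rep_lin ucoG)// !fctE /=.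
by rewrite pl.
Qed.

Section Family.
Variables (N : nat) (k : 'I_N -> 'I_n) (x : 'I_N -> 'I_d).
Local Notation G' := (pull_graph G x).

Lemma down_lin : linear_on H (down k x).
Proof.
by move=> a A B sA sB; apply/matrixP => i j; rewrite !mxE thG_lin// !mxE.
Qed.

Lemma down_supported B : supported H B -> supported G' (down k x B).
Proof.
move=> sB i j; rewrite mxE adjeq_pull_graph.
exact: rep_inv_supported (rangeG _ _ sB) _ _.
Qed.

Lemma down_pos (S : finType) (B : S -> S -> 'M[C]_d') :
  (forall a b, supported H (B a b)) ->
  (forall xi : S -> 'cV[C]_d', 0 <= \sum_a \sum_b cdot (B a b *m xi b) (xi a)) ->
  forall u : S -> 'cV[C]_N, 0 <= \sum_a \sum_b cdot (down k x (B a b) *m u b) (u a).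
Proof.
move=> sB pB u.
pose q (i : S * 'I_N) := p (k i.2); pose q' (i : S * 'I_N) := p' (k i.2).
have qq i : adjoint_pair (q i) (q' i) by exact: pp.
have rq (i j : S * 'I_N) : rep_range G phi (q' i \o rep psi (B i.1 j.1) \o q j).
  exact: rangeG.
have := compress_pos ucoG ucoH sB pB qq rq
  (fun i => u i.1 i.2 ord0 *: delta_mx (x i.2) ord0).
congr (0 <= _).
rewrite (sum_pair_pair (fun a i b j => cdot (thG (p' (k i) \o rep psi (B a b) \o p (k j)) *m
   (u b j ord0 *: delta_mx (x j) ord0)) (u a i ord0 *: delta_mx (x i) ord0))).
apply: eq_bigr => a _; apply: eq_bigr => b _; rewrite [RHS]cdot_mul_sum.
apply: eq_bigr => i _; apply: eq_bigr => j _.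
by rewrite -scalemxAr cdotZl cdotZr cdot_delta !mxE; ring.
Qed.

Lemma up_lin : linear_on G' (up k x).
Proof.
move=> a A B _ _; rewrite /up scaler_sumr -big_split /=; apply: eq_bigr => i _.
rewrite scaler_sumr -big_split /=; apply: eq_bigr => j _.
by rewrite !mxE scalerDl scalerA.
Qed.

Lemma up_supported A : supported G' A -> supported H (up k x A).
Proof.
move=> sA; apply: supported_sum => i _; apply: supported_sum => j _.
have [->|/sA Aij] := eqVneq (A i j) 0; first by rewrite scale0r; exact: supported0.
apply: supportedZ; apply: rep_inv_supported => //; apply: rangeH.
by apply: supported_delta; rewrite -adjeq_pull_graph.
Qed.

Lemma up_pos (S : finType) (A : S -> S -> 'M[C]_N) :
  (forall a b, supported G' (A a b)) ->
  (forall xi : S -> 'cV[C]_N, 0 <= \sum_a \sum_b cdot (A a b *m xi b) (xi a)) ->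
  forall u : S -> 'cV[C]_d', 0 <= \sum_a \sum_b cdot (up k x (A a b) *m u b) (u a).
Proof.
move=> sA pA u.
pose B (i j : S * 'I_N) : 'M[C]_d := A i.1 j.1 i.2 j.2 *: delta_mx (x i.2) (x j.2).
have sB i j : supported G (B i j).
  rewrite /B; have [->|/sA] := eqVneq (A i.1 j.1 i.2 j.2) 0.
    by rewrite scale0r; exact: supported0.
  by rewrite adjeq_pull_graph => h; apply: supportedZ; exact: supported_delta.
pose q (i : S * 'I_N) := p' (k i.2); pose q' (i : S * 'I_N) := p (k i.2).
have qq i : adjoint_pair (q i) (q' i) by exact: adjoint_pair_sym (pp _).
have rq (i j : S * 'I_N) : rep_range H psi (q' i \o rep phi (B i j) \o q j).
  exact: rangeH.
(* The matrix units select coordinates: the form of B at xi is that of A at the vectors whose i-th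
   entry is the (x i)-th coordinate of xi (a, i). *)
have pB xi : 0 <= \sum_i \sum_j cdot (B i j *m xi j) (xi i).
  have := pA (fun a => \col_i xi (a, i) (x i) ord0); congr (0 <= _).
  rewrite (eq_bigr (fun i => \sum_j A i.1 j.1 i.2 j.2 *
     (xi (j.1, j.2) (x j.2) ord0 * (xi (i.1, i.2) (x i.2) ord0)^*))); last first.
    move=> [a i] _; apply: eq_bigr => -[b j] _.
    by rewrite /B -scalemxAl cdotZl delta_form.
  rewrite (sum_pair_pair (fun a i b j => A a b i j *
     (xi (b, j) (x j) ord0 * (xi (a, i) (x i) ord0)^*))).
  apply: eq_bigr => a _; apply: eq_bigr => b _; rewrite cdot_mul_sum.
  by apply: eq_bigr => i _; apply: eq_bigr => j _; rewrite !mxE.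
have := compress_pos ucoH ucoG (s := id) sB pB qq rq (fun i => u i.1).
congr (0 <= _).
rewrite (sum_pair_pair (fun a i b j => cdot (thH (p (k i) \o rep phi
   (A a b i j *: delta_mx (x i) (x j)) \o p' (k j)) *m u b) (u a))).
apply: eq_bigr => a _; apply: eq_bigr => b _.
rewrite mulmx_suml cdot_suml; apply: eq_bigr => i _.
rewrite mulmx_suml cdot_suml; apply: eq_bigr => j _.
congr (cdot (_ *m _) _).
have [->|Aij] := eqVneq (A a b i j) 0.
  by rewrite !scale0r (linear_on0 (thH_lin _ _)).
rewrite (linear_onZ (thH_lin _ _))//; apply: supported_delta.
by rewrite -adjeq_pull_graph; exact: sA Aij.
Qed.

(** The module property splits theta(p_i^* p_a rep(E) p_b^* p_j) into theta(p_i^* p_a) E theta(p_b^*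
    p_j), whose outer factors contribute entries of the Gram matrix. *)
Lemma down_up A : supported G' A ->
  down k x (up k x A) = down k x 1%:M *m A *m down k x 1%:M.
Proof.
move=> sA; apply/matrixP => i j.
pose T (e : 'I_N * 'I_N) := p (k e.1) \o rep phi (delta_mx (x e.1) (x e.2)) \o p' (k e.2).
have rT e : A e.1 e.2 != 0 -> supported G (delta_mx (x e.1) (x e.2) : 'M[C]_d).
  by move=> /sA; rewrite adjeq_pull_graph; exact: supported_delta.
have [rU eU] := @rep_inv_sum _ _ _ _ _ ucoH _ (index_enum _) xpredT
  (fun e => A e.1 e.2) T (fun e _ Ae => rangeH _ _ (rT e Ae)).
have -> : up k x A = thH (\sum_e A e.1 e.2 *: T e).
  by rewrite eU /up pair_bigA.
rewrite mxE (rep_invK ucoH rU).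
have -> : p' (k i) \o (\sum_e A e.1 e.2 *: T e) \o p (k j) =
    \sum_e A e.1 e.2 *: (p' (k i) \o p (k e.1) \o rep phi (delta_mx (x e.1) (x e.2))
       \o (p' (k e.2) \o p (k j))).
  apply/funext => v; rewrite /= !fct_sumE (linear_fun_sum (pl' _)).
  by apply: eq_bigr => e _; rewrite !fctE (linear_funZ (pl' _)).
have [_ ->] := @rep_inv_sum _ _ _ _ _ ucoG _ (index_enum _) xpredT
  (fun e => A e.1 e.2) (fun e => p' (k i) \o p (k e.1) \o
     rep phi (delta_mx (x e.1) (x e.2)) \o (p' (k e.2) \o p (k j)))
  (fun e _ Ae => (rep_inv_mul2 ucoG (multG _ _) (multG _ _) (rT e Ae)).1).
have d1 a b : down k x 1%:M a b = thG (p' (k a) \o p (k b)) (x a) (x b).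
  by rewrite mxE (rep1 ucoH).
rewrite summxE -(pair_bigA _ (fun a b => (A a b *: thG (p' (k i) \o p (k a) \o
     rep phi (delta_mx (x a) (x b)) \o (p' (k b) \o p (k j)))) (x i) (x j))) /=.
rewrite -mulmxA mxE; apply: eq_bigr => a _.
rewrite [X in _ = _ * X]mxE mulr_sumr; apply: eq_bigr => b _.
rewrite [LHS]mxE; have [->|Aab] := eqVneq (A a b) 0; first by rewrite !(mul0r, mulr0).
rewrite (rep_inv_mul2 ucoG (multG _ _) (multG _ _) (rT (a, b) Aab)).2 /=.
rewrite !d1 mulrCA; congr (_ * _).
rewrite -(mul_delta_mx (0 : 'I_1)) -!mulmxA mulmxA -colE -rowE mxE big_ord1.
by rewrite !mxE.
Qed.

Lemma down_adj B : supported H B -> down k x (B^t*) = (down k x B)^t*.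
Proof.
move=> sB; apply/matrixP => i j; rewrite !mxE.
have h u v : inner ((p' (k j) \o rep psi B \o p (k i)) u) v =
    inner u ((p' (k i) \o rep psi (B^t*) \o p (k j)) v).
  have [_ _ h1] := pp (k i); have [_ _ h2] := adjoint_pair_sym (pp (k j)).
  by rewrite /= h2 (rep_adj ucoH)// h1.
by have [_ ->] := rep_inv_adj ucoG (rangeG (k j) (k i) sB) h; rewrite !mxE.
Qed.

Lemma down_psd B : supported H B -> psd B -> psd (down k x B).
Proof.
move=> sB pB v.
have := @down_pos 'I_1 (fun _ _ => B) (fun _ _ => sB) _ (fun=> v).
by rewrite !big_ord1; apply => xi; rewrite !big_ord1.
Qed.

Lemma down_block y z : adjeq H y z ->
  psd_block (down k x (delta_mx y y)) (down k x (delta_mx y z))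
            (down k x (delta_mx z y)) (down k x (delta_mx z z)).
Proof.
move=> yz u w.
pose B (s t : bool) : 'M[C]_d' := delta_mx (if s then y else z) (if t then y else z).
have sB s t : supported H (B s t).
  by apply: supported_delta; case: s t => -[]; rewrite ?adjeq_refl// adjeq_sym.
have := @down_pos bool B sB _ (fun s => if s then u else w).
rewrite !big_bool /= addrA; apply => xi; rewrite !big_bool /= addrA.
exact: delta_block.
Qed.

Lemma up_psd A : supported G' A -> psd A -> psd (up k x A).
Proof.
move=> sA pA v.
have := @up_pos 'I_1 (fun _ _ => A) (fun _ _ => sA) _ (fun=> v).
by rewrite !big_ord1; apply => xi; rewrite !big_ord1.
Qed.

Lemma up_block y z : adjeq G' y z ->
  psd_block (up k x (delta_mx y y)) (up k x (delta_mx y z))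
            (up k x (delta_mx z y)) (up k x (delta_mx z z)).
Proof.
move=> yz u w.
pose B (s t : bool) : 'M[C]_N := delta_mx (if s then y else z) (if t then y else z).
have sB s t : supported G' (B s t).
  by apply: supported_delta; case: s t => -[]; rewrite ?adjeq_refl// adjeq_sym.
have := @up_pos bool B sB _ (fun s => if s then u else w).
rewrite !big_bool /= addrA; apply => xi; rewrite !big_bool /= addrA.
exact: delta_block.
Qed.

(** The form of down 1 at v is a sum of nonnegative forms of the down E_yy, so each vanishes; the
    positive 2 x 2 blocks then give down E_yz v = 0 on every edge. *)
Lemma down_kernel B (v : 'cV[C]_N) : supported H B -> down k x 1%:M *m v = 0 ->
  down k x B *m v = 0.
Proof.
move=> sB v0.
have sd y : supported H (delta_mx y y : 'M[C]_d') := supported_delta (adjeq_refl H y).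
have psd_d y : psd (down k x (delta_mx y y)).
  by have [] := psd_block_psd (down_block (adjeq_refl H y)).
have vy y : cdot (down k x (delta_mx y y) *m v) v = 0.
  move: v0; rewrite mx1_sum_delta (linear_on_sum down_lin)//.
  rewrite mulmx_suml => /(congr1 (fun w => cdot w v)); rewrite cdot0l cdot_suml.
  move=> /eqP; rewrite psumr_eq0 => [/allP|z _]; last exact: psd_d.
  by move=> /(_ y); rewrite mem_index_enum => /(_ isT)/eqP.
rewrite (linear_on_delta down_lin sB) mulmx_suml big1// => i _.
rewrite mulmx_suml big1// => j _.
have [->|/sB Bij] := eqVneq (B i j) 0; first by rewrite scale0r mul0mx.
rewrite -scalemxAl (psd_block_eq0r (down_block Bij)) ?scaler0//.
Qed.

End Family.

(** With [full_x], this enumerates the whole family of the p_i (x) e_x. *)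
Definition full_k (i : 'I_#|{: 'I_n * 'I_d}|) : 'I_n := (enum_val i).1.
Definition full_x (i : 'I_#|{: 'I_n * 'I_d}|) : 'I_d := (enum_val i).2.

(** Summing over all pairs of basis vectors reassembles p_a p_a^* psi(B) p_b p_b^*, to which the
    module property over H applies. *)
Lemma up_down B : supported H B ->
  let b := \sum_a thH (p a \o p' a) in
  up full_k full_x (down full_k full_x B) = b *m B *m b.
Proof.
move=> sB /=.
pose F (e f : 'I_n * 'I_d) := thG (p' e.1 \o rep psi B \o p f.1) e.2 f.2 *:
  thH (p e.1 \o rep phi (delta_mx e.2 f.2) \o p' f.1).
have -> : up full_k full_x (down full_k full_x B) = \sum_e \sum_f F e f.
  rewrite [RHS](reindex (@enum_val _ {: 'I_n * 'I_d})) /=; last by apply: onW_bij; exact: enum_val_bij.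
  apply: eq_bigr => i _.
  rewrite [RHS](reindex (@enum_val _ {: 'I_n * 'I_d})) /=; last by apply: onW_bij; exact: enum_val_bij.
  by apply: eq_bigr => j _; rewrite mxE.
rewrite (sum_pair_pair (fun a i b j => thG (p' a \o rep psi B \o p b) i j *:
  thH (p a \o rep phi (delta_mx i j) \o p' b))).
rewrite mulmx_suml mulmx_suml; apply: eq_bigr => a _.
rewrite mulmx_sumr; apply: eq_bigr => b _.
have r := rangeG a b sB.
rewrite -(linear_on_delta (thH_lin a b)); last exact: rep_inv_supported.
rewrite (rep_invK ucoG r) -(rep_inv_mul2 ucoH (multH _ _) (multH _ _) sB).2.
by [].
Qed.

Hypothesis lowL : exists2 e : C, 0 < e &
  forall x, e * inner x x <= \sum_i inner (p i x) (p i x).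
Hypothesis lowK : exists2 e : C, 0 < e &
  forall x, e * inner x x <= \sum_i inner (p' i x) (p' i x).

Local Notation fk := full_k.
Local Notation fx := full_x.
Local Notation dn := (down fk fx).

(** The bound [lowK] carried through the inverse of psi. It makes the matrix b of [up_down]
    invertible, so that up after down reflects positivity. *)
Lemma gram_lower : exists2 e : C, 0 < e & psd (\sum_a thH (p a \o p' a) - e%:M).
Proof.
have [e e0 he] := lowK; exists e => //.
have r a : rep_range H psi (p a \o p' a) by have [] := multH a a.
have s a := rep_inv_supported ucoH (r a).
have sS : supported H (\sum_a thH (p a \o p' a)) by apply: supported_sum.
have -> : \sum_a thH (p a \o p' a) - e%:M = (- 1) *: e%:M + \sum_a thH (p a \o p' a).
  by rewrite scaleN1r addrC.
apply/(rep_psd ucoH) => [|x].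
  by apply: supported_lin => //; exact: supported_scalar.
rewrite (rep_lin ucoH)//; last exact: supported_scalar.
rewrite (linear_on_sum (rep_lin ucoH))// !fctE (rep_scalar ucoH).
rewrite innerDl !innerZl mulN1r addrC subr_ge0 fct_sumE inner_suml.
apply: (le_trans (he x)); rewrite le_eqVlt; apply/orP; left; apply/eqP.
apply: eq_bigr => a _; rewrite (rep_invK ucoH (r a)) /=.
by have [_ _ h] := pp a; rewrite h.
Qed.

(** By [lowL] the sum of these diagonal entries over a is at least e > 0. Thus every vertex is
    visible in the Gram matrix. *)
Lemma gram_diag_neq0 v : exists a, thG (p' a \o p a) v v != 0.
Proof.
have [e e0 he] := lowL.
have r a : rep_range G phi (p' a \o p a) by have [] := multG a a.
have s a := rep_inv_supported ucoG (r a).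
have sS : supported G (\sum_a thG (p' a \o p a)) by apply: supported_sum.
have : psd ((- 1) *: e%:M + \sum_a thG (p' a \o p a)).
  apply/(rep_psd ucoG) => [|x].
    by apply: supported_lin => //; exact: supported_scalar.
  rewrite (rep_lin ucoG)//; last exact: supported_scalar.
  rewrite (linear_on_sum (rep_lin ucoG))// !fctE (rep_scalar ucoG).
  rewrite innerDl !innerZl mulN1r addrC subr_ge0 fct_sumE inner_suml.
  apply: (le_trans (he x)); rewrite le_eqVlt; apply/orP; left; apply/eqP.
  apply: eq_bigr => a _; rewrite (rep_invK ucoG (r a)) /=.
  by have [_ _ h] := adjoint_pair_sym (pp a); rewrite h.
move=> /(_ (delta_mx v ord0)); rewrite cdot_delta !mxE eqxx mulN1r addrC subr_ge0.
move=> h; apply: contrapT => /forallNP no; move: h.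
rewrite summxE big1 => [|a _]; last by apply/eqP/negPn/negP; exact: no.
by rewrite mulr1n => /le_lt_trans/(_ e0); rewrite ltxx.
Qed.

Let s1 : supported H (1%:M : 'M[C]_d') := @supported_scalar R d' H 1.

Let g := dn 1%:M.

Let g_psd : psd g.
Proof.
by apply: down_psd => // v; rewrite mul1mx cdot_ge0.
Qed.

Let f := maxrankfun g.
Let N := \rank g.

Lemma down_factor B : supported H B -> (dn B <= g)%MS.
Proof.
move=> sB; apply: submx_cV => v; apply: down_kernel => //.
Qed.

Let gD : exists D, g = D *m rowsub f g.
Proof. by apply/submxP; rewrite eq_maxrowsub. Qed.

(* The rows f are a basis of the row space of the Hermitian matrix g, which
   contains the rows and, up to conjugation, the columns of every [dn B]. *)
Lemma gram_basis : exists D, (forall B, supported H B ->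
   dn B = D *m mxsub f f (dn B) *m D^t*) /\ g = D *m rowsub f g.
Proof.
have [D gE] := gD; exists D; split=> // B sB.
have gh := psd_adj g_psd.
have [Y BY] := submxP (down_factor sB).
have [Y' BY'] := submxP (down_factor (supported_adj sB)).
have BY2 : dn B = g *m Y'^t*.
  rewrite -{1}[B]trmxCK down_adj ?BY'; last exact: supported_adj.
  by rewrite adjmxM gh.
have gcol : g = colsub f g *m D^t*.
  by rewrite -[LHS]gh [in LHS]gE adjmxM hermitian_rowsub.
have e1 : dn B = D *m rowsub f (dn B).
  by rewrite {2}BY2 -mul_rowsub_mx mulmxA -gE.
have e2 : dn B = colsub f (dn B) *m D^t*.
  by rewrite {2}BY -mulmx_colsub -mulmxA -gcol.
rewrite {1}e1 {1}e2 -mul_rowsub_mx mulmxA; congr (_ *m _ *m _).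
by apply/matrixP => i j; rewrite !mxE.
Qed.

(** The selected rows of g are independent and factor as the minor times D^*, so the minor has full
    rank. *)
Lemma gram_minor_unit : mxsub f f g \in unitmx /\ (mxsub f f g)^t* = mxsub f f g.
Proof.
have gh := psd_adj g_psd.
split; last exact: hermitian_mxsub. have [D [_ gE]] := gram_basis.
have e : rowsub f g = mxsub f f g *m D^t*.
  have -> : mxsub f f g = rowsub f (colsub f g) by apply/matrixP => i j; rewrite !mxE.
  rewrite mul_rowsub_mx; congr (rowsub f _).
  by rewrite -[LHS]gh [in LHS]gE adjmxM hermitian_rowsub.
rewrite -row_free_unit -row_leq_rank.
have := maxrowsub_free g; rewrite -row_leq_rank -/f e.
by move=> h; apply: leq_trans h _; exact: mxrankM_maxl.
Qed.

Lemma gram_subfamily : exists N (x : 'I_N -> 'I_d) (Psi : 'M[C]_d' -> 'M[C]_N)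
    (Phi : 'M[C]_N -> 'M[C]_d'),
  [/\ forall v, exists i, twin G (x i) v,
      order_embedding H (pull_graph G x) Psi
    & order_embedding (pull_graph G x) H Phi].
Proof.
pose k := fk \o f; pose x := fx \o f.
have downE B : down k x B = mxsub f f (dn B).
  by apply/matrixP => i j; rewrite !mxE.
have [D [DE gE]] := gram_basis; have [hu hh] := gram_minor_unit.
exists N, x, (down k x), (up k x); split.
(* Since g = D (rowsub f g), a nonzero diagonal entry at (a, v) forces a nonzero entry in a selected
   row j; the multiplier p_j^* p_a then makes x j a twin of v. *)
- move=> v; have [a av] := gram_diag_neq0 v.
  pose i0 : 'I_#|{: 'I_n * 'I_d}| := enum_rank (a, v).
  have gv i : g i i0 = thG (p' (fk i) \o p a) (fx i) v.
    by rewrite mxE (rep1 ucoH) /full_k /full_x !enum_rankK.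
  have : g i0 i0 != 0 by rewrite gv /full_k /full_x enum_rankK.
  rewrite {1}gE mxE => nz.
  have [j nj] : exists j, rowsub f g j i0 != 0.
    apply: contrapT => /forallNP no; move: nz; rewrite big1 ?eqxx// => j _.
    by have /negP/negPn/eqP -> := no j; rewrite mulr0.
  exists j; move: nj; rewrite mxE gv.
  exact: (left_multiplier_twin ucoG (multG _ _) (multG _ _)).
- split.
  + exact: down_lin.
  (* Positivity of the minor extends to the full family by congruence with D; [up_down] and the
     invertibility of b bring it back to B. *)
  + move=> B sB; rewrite downE => /(psd_congr D); rewrite -DE// => pB.
    have sD : supported (pull_graph G fx) (dn B) by exact: (down_supported (k := fk) (x := fx) sB).
    have := up_psd fk sD pB.
    rewrite (up_down sB).
    have [e e0 /(posdef_unit e0)[bu bh]] := gram_lower.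
    exact: psd_congr_unit.
  + by move=> y z; exact: down_block.
  + by move=> B; exact: down_supported.
- split.
  + exact: up_lin.
  (* Going down again gives the congruence of A by the invertible Gram minor. *)
  + move=> A sA pA.
    have sU : supported H (up k x A) by exact: (up_supported (k := k) sA).
    have := down_psd k x sU pA.
    rewrite down_up// downE.
    exact: psd_congr_unit.
  + by move=> y z; exact: up_block.
  + by move=> A; exact: up_supported.
Qed.

End Transfer.

(** * The quotient by equality of closed neighbourhoods *)

Section TwinQuotient.
Variables (d : nat) (G : sgraph d).

Definition twinb u v := [forall w, adjeq G u w == adjeq G v w].

Lemma twinP u v : reflect (twin G u v) (twinb u v).
Proof.
by apply: (iffP forallP) => [h w|h w]; [exact/eqP|rewrite h eqxx].
Qed.

(** A choice depending only on the predicate, hence constant on twin classes; the default is never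
    reached, as v is its own twin. *)
Definition twin_rep v := odflt v [pick u | twinb u v].

Lemma twin_repP v : twin G (twin_rep v) v.
Proof.
by rewrite /twin_rep; case: pickP => [u /twinP//|/(_ v)/negP[]]; apply/twinP.
Qed.

Lemma twin_rep_eq u v : twin G u v -> twin_rep u = twin_rep v.
Proof.
move=> uv; have e : (twinb^~ u) =1 (twinb^~ v).
  by move=> w; apply/forallP/forallP => h t; rewrite (eqP (h t)) uv.
rewrite /twin_rep (eq_pick e); case: pickP => //= /(_ v)/negP[].
exact/twinP.
Qed.

Lemma twin_rep_idem v : twin_rep (twin_rep v) == twin_rep v.
Proof. by apply/eqP/twin_rep_eq/twin_repP. Qed.

Let Q := {u : 'I_d | twin_rep u == u}.

Definition twin_quotient : sgraph #|{: Q}| := 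
  pull_graph G (fun i => val (enum_val i : Q)).

Definition twin_class v : 'I_#|{: Q}| := 
  enum_rank (exist (fun u => twin_rep u == u) (twin_rep v) (twin_rep_idem v) : Q).

Lemma adjeq_twin_class u v :
  adjeq twin_quotient (twin_class u) (twin_class v) = adjeq G u v.
Proof.
rewrite adjeq_pull_graph /= !enum_rankK /=.
by rewrite twin_repP adjeq_sym twin_repP adjeq_sym.
Qed.

Lemma twin_class_eq u v : twin G u v -> twin_class u = twin_class v.
Proof. by move=> uv; congr enum_rank; apply: val_inj; exact: twin_rep_eq. Qed.

Lemma twin_class_surj i : exists v, twin_class v = i.
Proof.
exists (val (enum_val i)); rewrite -[RHS]enum_valK; congr enum_rank.
by apply: val_inj => /=; exact/eqP/(valP (enum_val i)).
Qed.

Lemma pullback_of_cover d' (H : sgraph d') (x : 'I_d' -> 'I_d) :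
  (forall y z, adjeq H y z = adjeq G (x y) (x z)) ->
  (forall v, exists y, twin G (x y) v) ->
  exists (k m : nat) (G' : sgraph k) (H' : sgraph m),
         [/\ pullback G G', pullback H H' & graph_iso G' H'].
Proof.
move=> hx cov; exists _, _, twin_quotient, twin_quotient; split.
- exists twin_class; split; first exact: twin_class_surj.
  by move=> u v; rewrite adjeq_twin_class.
- exists (twin_class \o x); split => [i|u v] /=; last by rewrite adjeq_twin_class hx.
  have [v <-] := twin_class_surj i; have [y yv] := cov v.
  by exists y; exact: twin_class_eq.
- by exists id => //; exists id.
Qed.

End TwinQuotient.

(** * Finite coercive families from non-degeneracy *)

Section Coercivity.
Variable R : realType.
Local Notation C := R[i].
Implicit Types L K : hilbertType R.

Lemma sum_norm_coercive L (n : nat) (a : 'I_n -> C) : (forall i, 0 <= a i) ->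
  exists2 e : C, 0 < e & forall (V : 'I_n -> hilbertType R) (r : forall i, V i) (x : L),
    `|x| <= \sum_i a i * `|r i| ->
    e * inner x x <= \sum_i inner (r i) (r i).
Proof.
move=> a0; set A := \sum_i a i.
have A0 : 0 <= A by apply: sumr_ge0.
have B0 : 0 < A ^+ 2 + 1 by rewrite ltr_wpDl// exprn_ge0.
(* Each |r_i| is at most the root of the sum S, so |x|^2 <= A^2 S; adding 1 covers the case A =
   0. *)
exists (A ^+ 2 + 1)^-1 => [|V r x hx]; first by rewrite invr_gt0.
have S0 : 0 <= \sum_i inner (r i) (r i) by apply: sumr_ge0 => i _; exact: inner_ge0.
rewrite ler_pdivrMl// inner_norm.
set S := \sum_i inner _ _ in S0 *.
have hr i : `|r i| <= sqrtC S.
  rewrite -[leLHS]sqrCK// ler_sqrtC ?nnegrE ?exprn_ge0// /S (bigD1 i)//= inner_norm lerDl.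
  by apply: sumr_ge0 => j _; exact: inner_ge0.
have : `|x| <= A * sqrtC S.
  by apply: (le_trans hx); rewrite mulr_suml ler_sum// => i _; rewrite ler_wpM2l.
rewrite -ler_sqr ?nnegrE ?mulr_ge0 ?sqrtC_ge0// exprMn sqrtCK => /le_trans; apply.
by rewrite mulrDl mul1r lerDl.
Qed.

Definition coercive_family L K (M : set (L -> K)) (n : nat)
    (p : 'I_n -> L -> K) (p' : 'I_n -> K -> L) :=
  forall i, [/\ M (p i), opadj M (p' i) & adjoint_pair (p i) (p' i)].

Lemma opadj_adjoint_pair L K (M : set (L -> K)) s' : M `<=` @bounded_op R L K ->
  opadj M s' -> exists2 s, M s & adjoint_pair s s'.
Proof.
by move=> Mb [[ls' _] [s Ms h]]; exists s => //; split=> //; have [] := Mb _ Ms.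
Qed.

Let half_add (t : C) : 2^-1 * t + 2^-1 * t = t.
Proof. by rewrite -mulrDl -[2^-1 + _]mulr2n -[_ *+ 2]mulr_natr mulVf ?mul1r// pnatr_eq0. Qed.

(* In S = sum c_i s_i^* t_i close to id, the t_i need not have adjoints; but
   <S x, x> = sum c_i <t_i x, s_i x>, so the s_i, which do, already bound x. *)
Lemma coercive_domain L K (M : set (L -> K)) : M `<=` @bounded_op R L K ->
  closed_span (opmul (opadj M) M) id ->
  exists n (p : 'I_n -> L -> K) (p' : 'I_n -> K -> L),
    coercive_family M p p' /\
    exists2 e : C, 0 < e & forall x, e * inner x x <= \sum_i inner (p i x) (p i x).
Proof.
move=> Mb [_ h].
have /h[S [n [c [u [hu SE]]]] hS] : (0 : C) < 2^-1 by rewrite invr_gt0 ltr0n.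
have {hu}hu i : exists q : (L -> K) * (K -> L) * (L -> K),
    [/\ M q.1.1, opadj M q.1.2, adjoint_pair q.1.1 q.1.2, M q.2 & u i = q.1.2 \o q.2].
  have [s' Ms' [t Mt <-]] := hu i; have [s Ms ss] := opadj_adjoint_pair Mb Ms'.
  by exists (s, s', t).
have [q hq] := choice hu.
exists n, (fun i => (q i).1.1), (fun i => (q i).1.2); split.
  by move=> i; have [] := hq i.
have hb i : exists b : C, 0 < b /\ forall x, `|(q i).2 x| <= b * `|x|.
  by have [_ _ _ /Mb/bounded_op_bound[b b0 hb] _] := hq i; exists b.
have [b {}hb] := choice hb.
(* The factor 2 makes up for the half lost to id - S. *)
have [|e e0 he] := @sum_norm_coercive L n (fun i => 2 * (`|c i| * b i)).
  by move=> i; rewrite !mulr_ge0// ltW//; exact: (hb i).1.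
exists e => // x; apply: (he (fun=> K) (fun i => (q i).1.1 x)).
have [->|x0] := eqVneq x 0.
  by rewrite normr0 sumr_ge0// => i _; rewrite !mulr_ge0// ltW//; exact: (hb i).1.
have n0 : 0 < `|x| by rewrite normr_gt0.
rewrite -(ler_pM2r n0) mulr_suml.
have xE : inner x x = inner ((id - S) x) x + \sum_i c i * inner ((q i).2 x) ((q i).1.1 x).
  have -> : \sum_i c i * inner ((q i).2 x) ((q i).1.1 x) = inner (S x) x.
    rewrite SE fct_sumE inner_suml; apply: eq_bigr => i _.
    have [_ _ [_ _ hh] _ ->] := hq i.
    by rewrite fctE innerZl (innerC _ ((q i).1.1 x)) hh -innerC.
  by rewrite -innerDl !fctE subrK.
have h1 : `|x| ^+ 2 <= 2^-1 * `|x| ^+ 2 + \sum_i `|c i| * b i * `|(q i).1.1 x| * `|x|.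
  rewrite -[leLHS]ger0_norm ?exprn_ge0// -[in leLHS]inner_norm [in leLHS]xE.
  apply: (le_trans (ler_normD _ _)); apply: lerD.
    apply: (le_trans (inner_cauchy_schwarz _ _)).
    by rewrite expr2 mulrA ler_wpM2r//; exact: hS.
  apply: (le_trans (ler_norm_sum _ _ _)); apply: ler_sum => i _.
  rewrite normrM -!mulrA ler_wpM2l//.
  apply: (le_trans (inner_cauchy_schwarz _ _)).
  rewrite mulrCA mulrC; apply: ler_wpM2l => //.
  exact: (hb i).2.
have h2 : 2^-1 * `|x| ^+ 2 <= \sum_i `|c i| * b i * `|(q i).1.1 x| * `|x|.
  by rewrite -(lerD2l (2^-1 * `|x| ^+ 2)); apply: le_trans h1; rewrite half_add.
rewrite (eq_bigr (fun i => 2 * (`|c i| * b i * `|(q i).1.1 x| * `|x|))).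
  by rewrite -mulr_sumr -expr2 -ler_pdivrMl ?ltr0n.
by move=> i _; rewrite !mulrA.
Qed.

(** Here S = sum c_i t_i s_i^* has the adjoints on the right, so the triangle inequality bounds |x|
    by |x| / 2 plus multiples of the |s_i^* x|. *)
Lemma coercive_codomain L K (M : set (L -> K)) : M `<=` @bounded_op R L K ->
  closed_span (opmul M (opadj M)) id ->
  exists n (p : 'I_n -> L -> K) (p' : 'I_n -> K -> L),
    coercive_family M p p' /\
    exists2 e : C, 0 < e & forall x, e * inner x x <= \sum_i inner (p' i x) (p' i x).
Proof.
move=> Mb [_ h].
have /h[S [n [c [u [hu SE]]]] hS] : (0 : C) < 2^-1 by rewrite invr_gt0 ltr0n.
have {hu}hu i : exists q : (L -> K) * (K -> L) * (L -> K),
    [/\ M q.1.1, opadj M q.1.2, adjoint_pair q.1.1 q.1.2, M q.2 & u i = q.2 \o q.1.2].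
  have [t Mt [s' Ms' <-]] := hu i; have [s Ms ss] := opadj_adjoint_pair Mb Ms'.
  by exists (s, s', t).
have [q hq] := choice hu.
exists n, (fun i => (q i).1.1), (fun i => (q i).1.2); split.
  by move=> i; have [] := hq i.
have hb i : exists b : C, 0 < b /\ forall x, `|(q i).2 x| <= b * `|x|.
  by have [_ _ _ /Mb/bounded_op_bound[b b0 hb] _] := hq i; exists b.
have [b {}hb] := choice hb.
have [|e e0 he] := @sum_norm_coercive K n (fun i => 2 * (`|c i| * b i)).
  by move=> i; rewrite !mulr_ge0// ltW//; exact: (hb i).1.
exists e => // x; apply: (he (fun=> L) (fun i => (q i).1.2 x)).
have h1 : `|x| <= 2^-1 * `|x| + \sum_i `|c i| * b i * `|(q i).1.2 x|.
  have {1}-> : x = (id - S) x + S x by rewrite !fctE subrK.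
  apply: (le_trans (ler_normD _ _)); apply: lerD; first exact: hS.
  rewrite SE fct_sumE.
  apply: (le_trans (ler_norm_sum _ _ _)); apply: ler_sum => i _.
  have [_ _ _ _ ->] := hq i; rewrite fctE normrZ -mulrA ler_wpM2l//.
  exact: (hb i).2.
have h2 : 2^-1 * `|x| <= \sum_i `|c i| * b i * `|(q i).1.2 x|.
  by rewrite -(lerD2l (2^-1 * `|x|)); apply: le_trans h1; rewrite half_add.
rewrite (eq_bigr (fun i => 2 * (`|c i| * b i * `|(q i).1.2 x|))).
  by rewrite -mulr_sumr -ler_pdivrMl ?ltr0n.
by move=> i _; rewrite !mulrA.
Qed.

End Coercivity.

(** T is a norm limit of operators T S with S in the span of X near the identity; these lie in the
    range, which is closed. This handles products p_i^* p_j rep A, which enter the range only after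
    composition with M^* M. *)
Lemma rep_range_absorb (R : realType) (d : nat) (G : sgraph d)
    (L : hilbertType R) phi (T : L -> L) (X : set (L -> L)) :
  unital_complete_order_embedding (graph_opsys R G) phi ->
  bounded_op T -> closed_span X id -> (forall u, X u -> rep_range G phi (T \o u)) ->
  rep_range G phi T.
Proof.
move=> uco bT [_ hX] hT; apply: rep_closed => //; split=> // e e0.
have [c c0 hc] := bounded_op_bound bT; have [lT _] := bT.
have /hX[S [n [a [u [hu SE]]]] hS] : 0 < e / c by rewrite divr_gt0.
have TS : T \o S = \sum_i a i *: (T \o u i).
  apply/funext => x; rewrite SE /= !fct_sumE (linear_fun_sum lT).
  by apply: eq_bigr => i _; rewrite !fctE (linear_funZ lT).
have [r _] := @rep_inv_sum _ _ _ _ _ uco _ (index_enum 'I_n) xpredT a (fun i => T \o u i)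
  (fun i _ _ => hT _ (hu i)).
exists (T \o S).
  rewrite TS; have [A sA ->] := r; exists (mx_op A) => //.
  by apply/graph_opsysP; exists A.
move=> x; rewrite !fctE.
have -> : T x - T (S x) = T ((id - S) x).
  by rewrite !fctE (linear_funD lT) (linear_funN lT).
apply: (le_trans (hc _)); rewrite -ler_pdivlMl// mulrA [c^-1 * e]mulrC.
exact: hS.
Qed.

(** * From Delta-equivalence to a covering map of vertices *)

Section DeltaToGraph.
Variables (R : realType) (d d' : nat) (G : sgraph d) (H : sgraph d').
Local Notation C := R[i].

Lemma Delta_equiv_cover : Delta_equiv (graph_opsys R G) (graph_opsys R H) ->
  exists x : 'I_d' -> 'I_d, (forall y z, adjeq H y z = adjeq G (x y) (x z)) /\
    forall v, exists y, twin G (x y) v.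
Proof.
move=> [L [K [phi [psi [ucoG ucoH [M [[Mb _ _] [ndL ndK] incG incH]]]]]]].
have rG s' t B : opadj M s' -> M t -> supported H B ->
    rep_range G phi (s' \o rep psi B \o t).
  move=> Ms' Mt sB; apply: (rep_closed ucoG); apply: incG.
  exists s' => //; exists (rep psi B \o t) => //; exists (rep psi B) => //; last by exists t.
  by exists (mx_op B) => //; apply/graph_opsysP; exists B.
have rH t s' A : M t -> opadj M s' -> supported G A ->
    rep_range H psi (t \o rep phi A \o s').
  move=> Mt Ms' sA; apply: (rep_closed ucoH); apply: incH.
  exists t => //; exists (rep phi A \o s') => //; exists (rep phi A) => //; last by exists s'.
  by exists (mx_op A) => //; apply/graph_opsysP; exists A.
have [n1 [p1 [p1' [c1 [e1 e10 low1]]]]] := coercive_domain Mb ndL.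
have [n2 [p2 [p2' [c2 [e2 e20 low2]]]]] := coercive_codomain Mb ndK.
(* The concatenated family satisfies both lower bounds, as the additional terms are nonnegative. *)
pose p (i : 'I_(n1 + n2)) := match fintype.split i with inl a => p1 a | inr a => p2 a end.
pose p' (i : 'I_(n1 + n2)) := match fintype.split i with inl a => p1' a | inr a => p2' a end.
have cp : coercive_family M p p'.
  by move=> i; rewrite /p /p'; case: (fintype.split i).
have Mp i : M (p i) by have [] := cp i.
have Mp' i : opadj M (p' i) by have [] := cp i.
have pp i : adjoint_pair (p i) (p' i) by have [] := cp i.
have bp i : bounded_op (p i) by exact: Mb.
have bp' i : bounded_op (p' i) by have [] := Mp' i.
have sG1 := @supported_scalar R d G 1; have sH1 := @supported_scalar R d' H 1.
have rangeG i j B : supported H B -> rep_range G phi (p' i \o rep psi B \o p j).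
  exact: rG.
have rangeH i j A : supported G A -> rep_range H psi (p i \o rep phi A \o p' j).
  exact: rH.
have pp2 i j : adjoint_pair (p' i \o p j) (p' j \o p i).
  have [l1 l1' h1] := pp i; have [l2 l2' h2] := pp j.
  split=> [a x y|a x y|x y] /=; rewrite ?l2 ?l1' ?l1 ?l2'//.
  by rewrite -h2 [LHS]innerC -h1 -innerC.
have pp2' i j : adjoint_pair (p i \o p' j) (p j \o p' i).
  have [l1 l1' h1] := pp i; have [l2 l2' h2] := pp j.
  split=> [a x y|a x y|x y] /=; rewrite ?l2' ?l1 ?l1' ?l2//.
  by rewrite h1 [LHS]innerC -h2 -innerC.
have multG i j : left_multiplier G phi (p' i \o p j) (p' j \o p i).
  split=> //.
  - by have := rangeG i j _ sH1; rewrite (rep1 ucoH).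
  (* In p_i^* p_j p_j^* p_i the middle p_j p_j^* is some psi(B), so the product lies in the range of
     phi. *)
  - have [B sB BE] := rangeH j j _ sG1; rewrite (rep1 ucoG) in BE.
    by have := rangeG i i _ sB; rewrite -BE.
  - move=> A sA; apply: (rep_range_absorb ucoG _ ndL).
      by apply: bounded_op_comp; [exact: bounded_op_comp|exact: (rep_bounded ucoG sA)].
    move=> u [s' Ms' [t Mt <-]].
    have [B sB BE] := rH _ _ _ (Mp j) Ms' sA.
    by have := rG _ _ _ (Mp' i) Mt sB; rewrite -BE.
have multH i j : left_multiplier H psi (p i \o p' j) (p j \o p' i).
  split=> //.
  - by have := rangeH i j _ sG1; rewrite (rep1 ucoG).
  - have [B sB BE] := rangeG j j _ sH1; rewrite (rep1 ucoH) in BE.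
    by have := rangeH i i _ sB; rewrite -BE.
  - move=> A sA; apply: (rep_range_absorb ucoH _ ndK).
      by apply: bounded_op_comp; [exact: bounded_op_comp|exact: (rep_bounded ucoH sA)].
    move=> u [t Mt [s' Ms' <-]].
    have [B sB BE] := rG _ _ _ (Mp' j) Mt sA.
    by have := rH _ _ _ (Mp i) Ms' sB; rewrite -BE.
have lowL : exists2 e : C, 0 < e &
    forall x, e * inner x x <= \sum_i inner (p i x) (p i x).
  exists e1 => // x; apply: (le_trans (low1 x)).
  rewrite big_split_ord /= -[leLHS]addr0; apply: lerD.
    by apply: ler_sum => i _; rewrite /p (unsplitK (inl i)).
  by apply: sumr_ge0 => i _; exact: inner_ge0.
have lowK : exists2 e : C, 0 < e &
    forall x, e * inner x x <= \sum_i inner (p' i x) (p' i x).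
  exists e2 => // x; apply: (le_trans (low2 x)).
  rewrite big_split_ord /= -[leLHS]add0r; apply: lerD.
    by apply: sumr_ge0 => i _; exact: inner_ge0.
  by apply: ler_sum => i _; rewrite /p' (unsplitK (inr i)).
have [N [x [Psi [Phi [cov oPsi oPhi]]]]] :=
  gram_subfamily ucoG ucoH pp rangeG rangeH multG multH lowL lowK.
have [s [sbij hs]] := order_embedding_iso oPsi oPhi.
exists (x \o s); split=> [y z|v]; first by rewrite hs adjeq_pull_graph.
have [i iv] := cov v; have [t st ts] := sbij.
by exists (t i); rewrite /= ts.
Qed.

End DeltaToGraph.

(** * The theorem *)

Section PullbackToTRO.
Variable R : realType.
Local Notation C := R[i].
Local Open Scope sesquilinear_scope.

Definition rect_op m n (A : 'M[C]_(m, n)) : euclid R n -> euclid R m :=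
  fun x => A *m x.

Definition entries_in m n (r : 'I_m -> 'I_n -> bool) (A : 'M[C]_(m, n)) :=
  forall i j, A i j != 0 -> r i j.

Lemma mul_entry_neq0 m n p (A : 'M[C]_(m, n)) (B : 'M[C]_(n, p)) i j :
  (A *m B) i j != 0 -> exists k, A i k != 0 /\ B k j != 0.
Proof.
rewrite mxE => nz; apply: contrapT => /forallNP no; move: nz.
rewrite big1 ?eqxx// => k _; apply/eqP.
by apply: contra_notT (no k); rewrite mulf_eq0 negb_or => /andP.
Qed.

Lemma rect_op_linear m n (A : 'M[C]_(m, n)) : linear (rect_op A).
Proof. by move=> a x y; rewrite /rect_op mulmxDr -scalemxAr. Qed.

Lemma rect_op_bounded m n (A : 'M[C]_(m, n)) : bounded_op (rect_op A).
Proof.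
split; first exact: rect_op_linear.
pose g : {linear euclid R n -> euclid R m} :=
  HB.pack (rect_op A) (GRing.isLinear.Build _ _ _ _ (rect_op A) (@rect_op_linear m n A)).
apply/(linear_bounded_continuous g)/linear_boundedP.
pose c := m%:R * \sum_i \sum_j `|A i j|.
have c0 : 0 <= c by rewrite mulr_ge0// sumr_ge0// => i _; exact: sumr_ge0.
exists c; split; first exact: ger0_real.
move=> r cr x; apply: (@le_trans _ _ (c * `|x|)); last by rewrite ler_wpM2r// ltW.
rewrite -mulrA; apply: euclid_norm_le.
  by rewrite mulr_ge0// sumr_ge0// => i _; exact: sumr_ge0.
move=> k; rewrite /= /rect_op mxE; apply: (le_trans (ler_norm_sum _ _ _)).
rewrite (bigD1 k)//= mulrDl; apply: ler_wpDr.
  by rewrite mulr_ge0// sumr_ge0// => i _; exact: sumr_ge0.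
rewrite mulr_suml; apply: ler_sum => j _.
by rewrite normrM ler_wpM2l//; exact: euclid_coord_le.
Qed.

Lemma rect_op_comp m n p (A : 'M[C]_(m, n)) (B : 'M[C]_(n, p)) :
  rect_op A \o rect_op B = rect_op (A *m B).
Proof. by apply/funext => x; rewrite /rect_op /= mulmxA. Qed.

Lemma rect_op_adj m n (A : 'M[C]_(m, n)) x y :
  inner (rect_op A x) y = inner x (rect_op (A^t*) y).
Proof. exact: cdot_adj. Qed.

Lemma opclosure_sub (L K : hilbertType R) (X : set (L -> K)) T :
  bounded_op T -> X T -> opclosure X T.
Proof.
move=> bT XT; split=> // e e0; exists T => // x.
by rewrite !fctE subrr normr0 mulr_ge0// ltW.
Qed.

Variables (d d' m : nat) (G : sgraph d) (H : sgraph d') (F : sgraph m).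
Variables (c : 'I_d -> 'I_m) (c' : 'I_d' -> 'I_m).
Hypothesis csurj : forall i, exists v, c v = i.
Hypothesis c'surj : forall i, exists v, c' v = i.
Hypothesis hc : forall u v, adjeq G u v = adjeq F (c u) (c v).
Hypothesis hc' : forall u v, adjeq H u v = adjeq F (c' u) (c' v).

Let fiber (y : 'I_d') (x : 'I_d) := c' y == c x.
Let M := @rect_op d' d @` [set A | entries_in fiber A].

(** An adjoint is determined by its operator, so M^* contains only conjugate transposes. *)
Let opadjM T : opadj M T <-> exists2 A, entries_in fiber A & T = rect_op (A^t*).
Proof.
split=> [[bT [_ [A hA <-]] h]|[A hA ->]].
  exists A => //; apply/funext => y; apply: inner_ext => x.
  by rewrite innerC -h rect_op_adj -innerC.
split; first exact: rect_op_bounded.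
by exists (rect_op A); [exists A|move=> x y; rewrite rect_op_adj].
Qed.

Let adj_entry (A : 'M[C]_(d', d)) i j : A^t* i j != 0 -> A j i != 0.
Proof. by rewrite !mxE conjC_eq0. Qed.

Lemma TRO_equiv_of_cover : TRO_equiv (graph_opsys R G) (graph_opsys R H).
Proof.
exists M; split.
- split.
  + by move=> _ [A _ <-]; exact: rect_op_bounded.
  + split.
      exists 0; first by move=> i j; rewrite mxE eqxx.
      by apply/funext => x; rewrite /rect_op mul0mx.
    move=> a _ _ [A hA <-] [B hB <-]; exists (a *: A + B).
      move=> i j; rewrite !mxE; have [->|/hA//] := eqVneq (A i j) 0.
      by rewrite mulr0 add0r => /hB.
    by apply/funext => x; rewrite /rect_op mulmxDl -scalemxAl.
  + move=> _ [_ [A hA <-] [_ [U /opadjM[B hB ->] [_ [D hD <-] <-]] <-]].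
    rewrite !rect_op_comp; exists (A *m (B^t* *m D)) => // i j.
    move=> /mul_entry_neq0[k [/hA/eqP e1 /mul_entry_neq0[l [/adj_entry/hB/eqP e2 /hD/eqP e3]]]].
    by rewrite /fiber e1 -e2 e3.
- have fd y x : c' y = c x -> entries_in fiber (delta_mx y x : 'M[C]_(d', d)).
    move=> yx i j; rewrite mxE; have [->|_] := eqVneq i y; last by rewrite eqxx.
    by have [->|_] := eqVneq j x; [rewrite /fiber yx eqxx|rewrite eqxx].
  have id_sum n (u : 'I_n -> euclid R n -> euclid R n) :
      (forall i, u i = rect_op (delta_mx i i)) -> id = \sum_i (1 : C) *: u i.
    move=> hu; apply/funext => x; rewrite fct_sumE -[LHS]mul1mx mx1_sum_delta mulmx_suml.
    by apply: eq_bigr => i _; rewrite fctE hu scale1r.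
  have bid n : bounded_op (id : euclid R n -> euclid R n).
    by split => //; move=> x; exact: cvg_id.
  split; apply: opclosure_sub => //.
    (* Each x has some y in the same fibre, and E_yx^* E_yx = E_xx; summing over x gives the
       identity. *)
    have [y hy] := choice (fun x => c'surj (c x)).
    exists d, (fun=> 1), (fun x => rect_op ((delta_mx (y x) x)^t*) \o rect_op (delta_mx (y x) x)).
    split=> [x|].
      exists (rect_op ((delta_mx (y x) x)^t*)).
        by apply/opadjM; exists (delta_mx (y x) x) => //; exact: fd.
      by exists (rect_op (delta_mx (y x) x)) => //; exists (delta_mx (y x) x) => //; exact: fd.
    apply: id_sum => x; rewrite rect_op_comp trmx_delta map_delta_mx mul_delta_mx//.
  have [x hx] := choice (fun y => csurj (c' y)).
  exists d', (fun=> 1), (fun y => rect_op (delta_mx y (x y)) \o rect_op ((delta_mx y (x y))^t*)).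
  split=> [y|].
    exists (rect_op (delta_mx y (x y))); first by exists (delta_mx y (x y)) => //; exact: fd.
    exists (rect_op ((delta_mx y (x y))^t*)) => //.
    by apply/opadjM; exists (delta_mx y (x y)) => //; exact: fd.
  apply: id_sum => y; rewrite rect_op_comp trmx_delta map_delta_mx mul_delta_mx//.
- move=> _ [_ /opadjM[A hA ->] [_ [V /graph_opsysP[B hB ->] [_ [D hD <-] <-]] <-]].
  rewrite -[mx_op B]/(rect_op B) !rect_op_comp; apply: opclosure_sub.
    exact: rect_op_bounded.
  apply/graph_opsysP; exists (A^t* *m (B *m D)) => // i j.
  (* A nonzero (i, j) entry yields k, l adjacent or equal in H with c' k = c i and c' l = c j, so
     the relation passes through F to i and j in G. *)
  move=> /mul_entry_neq0[k [/adj_entry/hA/eqP e1 /mul_entry_neq0[l [/hB e2 /hD/eqP e3]]]].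
  by rewrite hc -e1 -e3 -hc'.
- move=> _ [_ [A hA <-] [_ [V /graph_opsysP[B hB ->] [_ /opadjM[D hD ->] <-]] <-]].
  rewrite -[mx_op B]/(rect_op B) !rect_op_comp; apply: opclosure_sub.
    exact: rect_op_bounded.
  apply/graph_opsysP; exists (A *m (B *m D^t*)) => // i j.
  move=> /mul_entry_neq0[k [/hA/eqP e1 /mul_entry_neq0[l [/hB e2 /adj_entry/hD/eqP e3]]]].
  by rewrite hc' e1 e3 -hc.
Qed.

End PullbackToTRO.

Lemma TRO_equiv_Delta (R : realType) d d' (G : sgraph d) (H : sgraph d') :
  TRO_equiv (graph_opsys R G) (graph_opsys R H) ->
  Delta_equiv (graph_opsys R G) (graph_opsys R H).
Proof.
have uco n (F : sgraph n) : unital_complete_order_embedding (graph_opsys R F) id.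
  split=> //; first by move=> _ /graph_opsysP[A _ ->]; exact: rect_op_bounded.
  by move=> k T _; rewrite map_mx_id.
move=> h; exists (euclid R d), (euclid R d'), id, id; split=> //.
by rewrite !image_id.
Qed.

Theorem corollary7p6 (R : realType) (d d' : nat) (G : sgraph d) (H : sgraph d') :
  [<-> TRO_equiv (graph_opsys R G) (graph_opsys R H);
       Delta_equiv (graph_opsys R G) (graph_opsys R H);
       exists (k m : nat) (G' : sgraph k) (H' : sgraph m),
         [/\ pullback G G', pullback H H' & graph_iso G' H']].
Proof.
tfae.
- exact: TRO_equiv_Delta.
- by move=> /Delta_equiv_cover[x [hx cov]]; exact: pullback_of_cover hx cov.
- move=> [k [m [G' [H' [[f [fs hf] [g [gs hg] [h hbij hadj]]]]]]]].
  have [h' hK h'K] := hbij.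
  (* The common graph is H', with G mapped to it through the isomorphism h; injectivity of h carries
     adjacency over to the relation including equality. *)
  apply: (@TRO_equiv_of_cover R d d' m G H H' (h \o f) g) => //.
  + by move=> i; have [v vi] := fs (h' i); exists v; rewrite /= vi h'K.
  + move=> u v; apply/idP/idP => [/hf|huv]; last apply/hf.
      by rewrite /adjeq /= (inj_eq (can_inj hK)) => /orP[/hadj ->//|->]; rewrite orbT.
    move: huv; rewrite /adjeq /= (inj_eq (can_inj hK)) => /orP[/hadj ->//|->].
    by rewrite orbT.
  + by move=> u v; apply/idP/idP => /hg.
Qed.
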